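(* Let $H$ be a complex Hilbert space and let $K(H)$ be the space of all compact linear operators on $H$ with the operator norm. Then $K(H)$ satisfies the Mazur--Ulam property: for every real Banach space $Y$, every surjective isometry from $S(K(H))$ onto $S(Y)$ admits a unique extension to a surjective real linear isometry from $K(H)$ onto $Y$.
   Context: $S(X)$ denotes the unit sphere of a Banach space $X$ (with the metric induced by the norm). An isometry is a distance-preserving map; no linearity is assumed. *)

(* Defs.v *)
From HB Require Import structures.
From mathcomp Require Import all_boot all_order all_algebra.
From mathcomp.real_closed Require Import complex.
From mathcomp Require Import all_classical all_reals.
From mathcomp Require Import topology normedtype.

Set Implicit Arguments.
Unset Strict Implicit.
Unset Printing Implicit Defensive.

Import Order.TTheory GRing.Theory Num.Theory Num.Def.
Import numFieldNormedType.Exports.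

Local Open Scope classical_set_scope.
Local Open Scope ring_scope.
Local Open Scope complex_scope.

(** Norms in a [normedModType R[i]] take their values in [R[i]]; they are
    nonnegative, hence real, and [rnorm] is the corresponding element of [R]. *)
Definition rnorm (R : realType) (V : normedModType R[i]) (v : V) : R :=
  complex.Re `|v|.

Lemma rnormE (R : realType) (V : normedModType R[i]) (v : V) :
  (rnorm v)%:C = `|v|.
Proof. by rewrite /rnorm RRe_real// ger0_real. Qed.

Lemma normcR (R : realType) (a : R) : `|a%:C| = `|a|%:C.
Proof. by rewrite normc_def/= expr0n/= addr0 sqrtr_sqr. Qed.

(** The real normed space underlying a complex normed space. *)
Definition realification (R : realType) (V : normedModType R[i]) : Type := V.

Section realification.
Context (R : realType) (V : normedModType R[i]).

HB.instance Definition _ := GRing.Zmodule.copy (realification V) V.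

Definition realscale (a : R) (v : realification V) : realification V :=
  a%:C *: (v : V).

Lemma realscaleA a b v : realscale a (realscale b v) = realscale (a * b) v.
Proof. by rewrite /realscale scalerA rmorphM. Qed.

Lemma realscale1 : left_id 1 realscale.
Proof. by move=> v; rewrite /realscale rmorph1 scale1r. Qed.

Lemma realscaleDr : right_distributive realscale +%R.
Proof. by move=> a u v; rewrite /realscale scalerDr. Qed.

Lemma realscaleDl v : {morph realscale^~ v : a b / a + b}.
Proof. by move=> a b; rewrite /realscale rmorphD scalerDl. Qed.

HB.instance Definition _ := GRing.Zmodule_isLmodule.Build R (realification V)
  realscaleA realscale1 realscaleDr realscaleDl.

Let norm (v : realification V) : R := rnorm (v : V).

Let norm_triangle u v : norm (u + v) <= norm u + norm v.
Proof. by rewrite -lecR rmorphD/= !rnormE ler_normD. Qed.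

Let normZ (a : R) v : norm (a *: v) = `|a| * norm v.
Proof. by apply: complexI; rewrite rmorphM/= !rnormE normrZ normcR. Qed.

Let norm0_eq0 v : norm v = 0 -> v = 0.
Proof.
by move=> v0; apply: (@normr0_eq0 _ V v); rewrite -rnormE -/(norm v) v0.
Qed.

HB.instance Definition _ := @Lmodule_isNormed.Build R (realification V)
  norm norm_triangle normZ norm0_eq0.

Lemma realification_normE (v : realification V) : `|v| = rnorm (v : V).
Proof. by []. Qed.

End realification.

Section compact_operators.
Context (R : realType) (H : normedModType R[i]).
Implicit Types (S T : H -> H).

Definition unit_ball : set H := [set x | `|x| <= 1].

Definition compact_operator T : Prop := linear T /\ precompact (T @` unit_ball).

Definition compact_op_pred : {pred H -> H} := fun T => `[< compact_operator T >].

Record compact_op := CompactOp {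
  compact_op_fun :> H -> H ;
  _ : compact_op_fun \in compact_op_pred }.

HB.instance Definition _ := [isSub for compact_op_fun].
HB.instance Definition _ := [Choice of compact_op by <:].

Lemma compact_opP (T : compact_op) : compact_operator T.
Proof. by case: T => T /= /asboolP. Qed.

HB.instance Definition _ (T : compact_op) :=
  GRing.isLinear.Build R[i] H H *:%R T (compact_opP T).1.

Lemma compact_operator0 : compact_operator 0.
Proof.
split; first by move=> a x y; rewrite -[LHS]/(0 : H) -[X in _ + X]/(0 : H) -[X in _ *: X]/(0 : H) scaler0 addr0.
apply: (@precompact_subset _ _ [set 0]); first by move=> _ [x _ <-].
by apply: compact_precompact; [exact: norm_hausdorff|exact: compact_set1].
Qed.

Lemma compact_operatorDZ (a : R[i]) S T :
  compact_operator S -> compact_operator T -> compact_operator (a *: S + T).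
Proof.
move=> [linS cS] [linT cT]; split.
  have E x : (a *: S + T) x = a *: S x + T x by [].
  move=> b x y; rewrite !E linS linT !scalerDr !scalerA (mulrC a).
  by rewrite addrACA.
rewrite precompactE in cS; rewrite precompactE in cT.
pose f (z : H * H) := a *: z.1 + z.2.
have cf : continuous f.
  move=> z; apply: cvgD; last exact: cvg_snd.
  by apply: cvgZr; exact: cvg_fst.
apply: (@precompact_subset _ _ (f @` (closure (S @` unit_ball) `*`
                                      closure (T @` unit_ball)))).
  move=> _ [x Bx <-]; exists (S x, T x) => //.
  by split=> /=; apply: subset_closure; exists x.
apply: compact_precompact; first exact: norm_hausdorff.
apply: continuous_compact; last exact: compact_setX.
exact: continuous_subspaceT.
Qed.

Lemma compact_op_submod : submod_closed compact_op_pred.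
Proof.
split; first by apply/asboolP; exact: compact_operator0.
move=> a S T /asboolP cS /asboolP cT; apply/asboolP.
exact: compact_operatorDZ.
Qed.

HB.instance Definition _ :=
  GRing.isSubmodClosed.Build _ _ compact_op_pred compact_op_submod.
HB.instance Definition _ := [SubChoice_isSubLmodule of compact_op by <:].

(** The operator norm. *)
Definition opnorm T : R := sup [set rnorm (T x) | x in unit_ball].

Lemma compact_op_bounded (T : compact_op) :
  has_ubound [set rnorm (T x) | x in unit_ball].
Proof.
have [_] := compact_opP T; rewrite precompactE => /compact_near_coveringP.
move=> /(_ R (pinfty_nbhs R) (fun r x => rnorm x <= r)) cov.
have : \forall r \near +oo%R, closure (T @` unit_ball) `<=` (fun x => rnorm x <= r).
  apply: cov => y _.
  exists (ball y 1, [set r | rnorm y + 1 <= r]).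
    by split; [exact: nbhsx_ballx|apply: nbhs_pinfty_ge; exact: num_real].
  move=> [z r] [/= + yr]; rewrite -ball_normE/= => /ltW yz.
  apply: le_trans yr; rewrite -lecR rmorphD/= !rnormE rmorph1 -lerBlDl.
  by rewrite (le_trans (lerB_dist _ _))// distrC.
move=> /pinfty_ex_gt0[r _ rP]; exists r => _ [x Bx <-].
by apply: rP; apply: subset_closure; exists x.
Qed.

Let has_sup_opnorm (T : compact_op) :
  has_sup [set rnorm (T x) | x in unit_ball].
Proof.
split; last exact: compact_op_bounded.
by exists (rnorm (T 0)), 0 => //; rewrite /unit_ball/= normr0 ler01.
Qed.

Lemma opnorm_ub (T : compact_op) x : `|x| <= 1 -> rnorm (T x) <= opnorm T.
Proof. by move=> x1; apply: ub_le_sup; [exact: compact_op_bounded|exists x]. Qed.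

Let opnorm_le (T : compact_op) (r : R) :
  (forall x, `|x| <= 1 -> rnorm (T x) <= r) -> opnorm T <= r.
Proof.
move=> Tr; apply: ge_sup; first by have [] := has_sup_opnorm T.
by move=> _ [x Bx <-]; exact: Tr.
Qed.

Let norm (T : compact_op) : R[i] := (opnorm T)%:C.

Let norm_triangle (S T : compact_op) : norm (S + T) <= norm S + norm T.
Proof.
rewrite /norm -rmorphD lecR; apply: opnorm_le => x x1.
apply: (le_trans _ (lerD (opnorm_ub S x1) (opnorm_ub T x1))).
by rewrite -lecR rmorphD/= !rnormE ler_normD.
Qed.

Let rnormZ (a : R[i]) (x : H) : rnorm (a *: x) = complex.Re `|a| * rnorm x.
Proof.
by apply: complexI; rewrite rmorphM/= rnormE normrZ RRe_real ?ger0_real// rnormE.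
Qed.

Let opnormZ_le (a : R[i]) (T : compact_op) :
  opnorm (a *: T) <= complex.Re `|a| * opnorm T.
Proof.
apply: opnorm_le => x x1; rewrite [X in rnorm X](_ : _ = a *: T x)// rnormZ.
apply: ler_wpM2l; last exact: opnorm_ub.
by rewrite -lecR RRe_real ?ger0_real// normr_ge0.
Qed.

Let opnorm0 : opnorm (0 : compact_op) = 0.
Proof.
apply/eqP; rewrite eq_le; apply/andP; split.
  by apply: opnorm_le => x _; rewrite -lecR rnormE normr0.
have x1 : `|0 : H| <= 1 by rewrite normr0 ler01.
by apply: le_trans (opnorm_ub 0 x1); rewrite -lecR rnormE; exact: normr_ge0.
Qed.

Let norm0_eq0 (T : compact_op) : norm T = 0 -> T = 0.
Proof.
move=> /complexI T0; apply/val_inj/funext => x /=.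
have [->|x0] := eqVneq x 0; first by rewrite linear0.
have : rnorm (T (`|x|^-1 *: x)) <= 0.
  rewrite -T0; apply: opnorm_ub.
  by rewrite normrZ normfV normr_id mulVf// normr_eq0.
rewrite -lecR rnormE normr_le0 linearZ scaler_eq0 invr_eq0 normr_eq0.
by rewrite (negbTE x0) => /eqP.
Qed.

Let normZ (a : R[i]) (T : compact_op) : norm (a *: T) = `|a| * norm T.
Proof.
have aE : (complex.Re `|a|)%:C = `|a| by rewrite RRe_real// ger0_real.
have [->|a0] := eqVneq a 0.
  by rewrite scale0r normr0 mul0r /norm opnorm0.
rewrite /norm -aE -rmorphM/=; congr (_%:C); apply/eqP; rewrite eq_le opnormZ_le/=.
have an0 : 0 < complex.Re `|a| by rewrite -ltcR aE normr_gt0.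
rewrite mulrC -ler_pdivlMr// mulrC.
have := opnormZ_le a^-1 (a *: T); rewrite scalerA mulVf// scale1r.
move=> /le_trans; apply; rewrite le_eqVlt; apply/orP; left; apply/eqP.
congr (_ * _); apply: complexI.
by rewrite fmorphV !RRe_real ?ger0_real// normfV.
Qed.

HB.instance Definition _ := @Lmodule_isNormed.Build R[i] compact_op
  norm norm_triangle normZ norm0_eq0.

Lemma compact_op_normE (T : compact_op) : `|T| = (opnorm T)%:C.
Proof. by []. Qed.

End compact_operators.

Arguments compact_op {R} H.

Section mazur_ulam.
Context {R : realType}.

Definition unit_sphere (X : normedModType R) : set X := [set x | `|x| = 1].

Definition isometry_on (X Y : normedModType R) (A : set X) (f : X -> Y) : Prop :=
  forall x y, A x -> A y -> `|f x - f y| = `|x - y|.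

(** A map between unit spheres is represented by a total function [f : X -> Y]
    whose values outside the unit sphere of [X] play no role. *)
Definition mazur_ulam_property (X : normedModType R) : Prop :=
  forall (Y : completeNormedModType R) (f : X -> Y),
    set_fun (@unit_sphere X) (@unit_sphere Y) f ->
    set_surj (@unit_sphere X) (@unit_sphere Y) f ->
    isometry_on (@unit_sphere X) f ->
  exists! F : X -> Y, [/\ linear F, set_surj setT setT F, isometry_on setT F
                        & {in @unit_sphere X, F =1 f}].

End mazur_ulam.

(* Main.v *)
Require Import Defs.
From mathcomp Require Import all_boot all_order all_algebra.
From mathcomp.real_closed Require Import complex.
From mathcomp Require Import all_classical all_reals.
From mathcomp Require Import topology normedtype.
From mathcomp Require Import finmap ring lra.

Set Implicit Arguments.
Unset Strict Implicit.
Unset Printing Implicit Defensive.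

Import Order.TTheory GRing.Theory Num.Theory Num.Def.
Import numFieldNormedType.Exports.
Local Open Scope ring_scope.
Local Open Scope complex_scope.

(* Let [f] be a surjective isometry between the unit spheres of [X = K(H)] and [Y].
   It suffices to find, for every [z] in the sphere of [X], a linear functional [psi]
   on [Y] such that [psi \o f] is the restriction of a linear functional [phi] with
   [phi z = 1]: such [psi] separate the points of [Y] and are additive along the
   homogeneous extension of [f].

   For unit vectors [u], [w] let [face u w] be the set of norm one operators mapping
   [u] to [w]. By compactness these faces cover the sphere, and [face u w] is the set
   of points at distance [2] from the opposite of the rank one operator [<., u> w];
   from this one deduces that [f] maps it onto a convex set. If [T] is block diagonal
   with respect to [u], [w] with corner entry [a], its distance to
   [face u (b *: w)] is [|b - a|] for all [|b| = 1]; conversely, by strict convexity of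
   [H], these distances detect the corner entry and the block structure. Hence [f] is
   affine on the operators of norm one that are diagonal in two given finite
   orthonormal frames and have a common entry [1], and odd on real diagonal ones.

   When [dim H > 1], the homogeneous extension of [f] is therefore real linear on
   [C e + C e'] for orthogonal rank one [e], [e']. The operators
   [r (<., x> y + <., z> v) + s (<., x> v - <., z> y)], with [(x, z)] and [(y, v)]
   orthonormal, lie in one such plane, and regrouping their rows and columns shows that
   the extension is additive in each variable of [<., u> w]. As the norm is smooth at
   rank one operators, a norming functional [psi] of [f (<., u> w)] must satisfy
   [psi (f T) = Re <T u, w>] for [T] of rank one, then for finite diagonal [T], and
   finally for all compact [T] by approximate singular value decomposition.

   When [dim H = 1], [X] is an inner product space and the parallelogram law shows that
   [f] preserves midpoints of arcs. *)

(** * Norming functionals *)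

Section linear_fun.
Context (R : pzRingType) (U V : lmodType R) (f : U -> V).
Hypothesis lf : linear f.

Lemma linear_fun0 : f 0 = 0.
Proof. by have := lf (-1) 0 0; rewrite scaler0 addr0 scaleN1r addNr. Qed.

Lemma linear_funZ a u : f (a *: u) = a *: f u.
Proof. by have := lf a u 0; rewrite !addr0 linear_fun0 addr0. Qed.

Lemma linear_funD u v : f (u + v) = f u + f v.
Proof. by have := lf 1 u v; rewrite !scale1r. Qed.

Lemma linear_funN u : f (- u) = - f u.
Proof. by rewrite -scaleN1r linear_funZ scaleN1r. Qed.

Lemma linear_funB u v : f (u - v) = f u - f v.
Proof. by rewrite linear_funD linear_funN. Qed.

End linear_fun.

Section sublinear.
Context (R : realType) (V : lmodType R).

Definition sublinear (p : V -> R) : Prop :=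
  (forall u v, p (u + v) <= p u + p v) /\
  (forall a v, 0 <= a -> p (a *: v) = a * p v).

Lemma sublinear0 p : sublinear p -> p 0 = 0.
Proof. by move=> [_ pZ]; rewrite -(scale0r (0 : V)) pZ// mul0r. Qed.

Lemma sublinear_ge p v : sublinear p -> - p (- v) <= p v.
Proof.
move=> ps; have [pD _] := ps.
by rewrite lerNl -subr_ge0 opprK -(sublinear0 ps) -(subrr v) addrC pD.
Qed.

(* The largest sublinear functional below [p] with value [- p z] at [- z]. *)
Definition sublinear_tighten (p : V -> R) (z v : V) : R :=
  inf [set r | exists2 t, 0 <= t & r = p (v + t *: z) - t * p z]%classic.

Lemma sublinear_tighten_le p z v t : sublinear p -> 0 <= t ->
  sublinear_tighten p z v <= p (v + t *: z) - t * p z.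
Proof.
move=> ps t0; apply: ge_inf; last by exists t.
exists (- p (- v)) => _ [s s0 ->]; have [pD pZ] := ps.
have := pD (v + s *: z) (- v).
rewrite [v + _]addrC addrK pZ// addrC; lra.
Qed.

Lemma le_sublinear_tighten p z v r :
  (forall t, 0 <= t -> r <= p (v + t *: z) - t * p z) ->
  r <= sublinear_tighten p z v.
Proof.
move=> H; apply: lb_le_inf.
  by exists (p (v + 0 *: z) - 0 * p z); exists 0.
by move=> _ [s s0 ->]; exact: H.
Qed.

(** Under subadditivity the parameters [t] and [s] add up. For homogeneity, rescaling the parameter
    gives one inequality, and the other is the first one applied with [a^-1]. *)
Lemma sublinear_tightenP p z : sublinear p -> sublinear (sublinear_tighten p z).
Proof.
move=> ps; have [pD pZ] := ps; split.
  move=> u v; rewrite -lerBlDl; apply: le_sublinear_tighten => t t0.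
  rewrite lerBlDl -lerBlDr; apply: le_sublinear_tighten => s s0.
  have := sublinear_tighten_le z (u + v) ps (addr_ge0 s0 t0).
  have := pD (u + s *: z) (v + t *: z).
  rewrite addrACA -scalerDl mulrDl; lra.
have le1 b w : 0 < b ->
    sublinear_tighten p z (b *: w) <= b * sublinear_tighten p z w.
  move=> b0; rewrite mulrC -ler_pdivrMr//; apply: le_sublinear_tighten => t t0.
  rewrite ler_pdivrMr// mulrC.
  have := sublinear_tighten_le z (b *: w) ps (mulr_ge0 (ltW b0) t0).
  rewrite -scalerA -scalerDr (pZ _ _ (ltW b0)); lra.
move=> a v; rewrite le_eqVlt => /predU1P[<-|a0].
  rewrite scale0r mul0r; apply/eqP; rewrite eq_le; apply/andP; split.
    have := sublinear_tighten_le z 0 ps (lexx 0).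
    by rewrite scale0r addr0 (sublinear0 ps) mul0r subr0.
  by apply: le_sublinear_tighten => t t0; rewrite add0r pZ// subrr.
apply/eqP; rewrite eq_le le1//=.
rewrite mulrC -ler_pdivlMr//.
have := le1 a^-1 (a *: v); rewrite scalerA mulVf ?gt_eqF// scale1r invr_gt0.
by move=> /(_ a0); rewrite mulrC.
Qed.

(** By minimality [p] equals its own tightening at every [v]; the parameter 1 then yields
    [p u <= p (u + v) - p v], the missing half of additivity. *)
Lemma minimal_sublinear_linear p : sublinear p ->
  (forall q, sublinear q -> (forall v, q v <= p v) -> q = p) ->
  linear (p : V -> R^o).
Proof.
move=> ps pmin; have [pD pZ] := ps.
have addp u v : p (u + v) = p u + p v.
  apply/eqP; rewrite eq_le pD/=.
  have <- : sublinear_tighten p v = p.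
    apply: pmin; first exact: sublinear_tightenP.
    move=> w; have := sublinear_tighten_le v w ps (lexx 0).
    by rewrite scale0r addr0 mul0r subr0.
  have := sublinear_tighten_le v u ps ler01.
  have := sublinear_tighten_le v v ps (lexx 0).
  rewrite scale0r scale1r addr0 mul0r mul1r subr0.
  have -> : sublinear_tighten p v = p.
    apply: pmin; first exact: sublinear_tightenP.
    move=> w; have := sublinear_tighten_le v w ps (lexx 0).
    by rewrite scale0r addr0 mul0r subr0.
  lra.
have pN u : p (- u) = - p u.
  by apply/eqP; rewrite -subr_eq0 opprK -addp addNr (sublinear0 ps).
move=> a u v; rewrite addp; congr (_ + _).
have [a0|a0] := leP 0 a; first exact: pZ.
have := pN (- a *: u); rewrite pZ ?oppr_ge0 ?ltW// scaleNr opprK => ->.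
by rewrite mulNr opprK.
Qed.

(** Zorn's lemma on the sublinear functionals below [p], ordered downwards; a minimal one is
    linear. *)
Lemma sublinear_above_linear p : sublinear p ->
  exists q : V -> R, linear (q : V -> R^o) /\ forall v, q v <= p v.
Proof.
move=> ps.
pose S := {q : V -> R | sublinear q /\ forall v, q v <= p v}.
pose le (r s : S) := `[< forall v, sval s v <= sval r v >].
have lb (s : S) v : - p (- v) <= sval s v.
  case: s => s /= [ss sp]; apply: le_trans (sublinear_ge v ss).
  by rewrite lerN2 sp.
have [| | | |] := @Zorn S le.
- by move=> s; apply/asboolP.
- by move=> r s t /asboolP rs /asboolP st; apply/asboolP => v; apply: le_trans (rs v).
- move=> [s Ps] [t Pt] /asboolP/= st /asboolP/= ts; apply/eq_exist/funext => v.
  by apply/eqP; rewrite eq_le st ts.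
- move=> A Atot.
  have [[s0 As0]|A0] := pselect (exists s, A s); last first.
    exists (exist _ p (conj ps (fun v => lexx _))) => s As.
    by case: A0; exists s.
  (* The bound of a nonempty chain is its pointwise infimum, finite because [- p (- v)] is a lower
     bound. Subadditivity uses comparability: of two members taken at [u] and at [v], the smaller
     one serves at both. *)
  pose m v := inf [set sval s v | s in A]%classic.
  have m_le s v : A s -> m v <= sval s v.
    move=> As; apply: ge_inf; last by exists s.
    by exists (- p (- v)) => _ [r _ <-]; exact: lb.
  have le_m v r : (forall s, A s -> r <= sval s v) -> r <= m v.
    move=> H; apply: lb_le_inf; first by exists (sval s0 v), s0.
    by move=> _ [s As <-]; exact: H.
  have ms : sublinear m.
    split=> [u v|a v a0].
      rewrite -lerBlDl; apply: (le_m) => t At.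
      rewrite lerBlDl -lerBlDr; apply: (le_m) => s As.
      rewrite lerBlDr.
      have [/asboolP st|/asboolP ts] := Atot _ _ As At.
        apply: (le_trans (m_le _ _ At)).
        case: t st {At} => t [[tD _] ?] /= st.
        by apply: (le_trans (tD _ _)); rewrite lerD2r st.
      apply: (le_trans (m_le _ _ As)).
      case: s ts {As} => s [[sD _] ?] /= ts.
      by apply: (le_trans (sD _ _)); rewrite lerD2l ts.
    apply/eqP; rewrite eq_le; apply/andP; split; last first.
      apply: (le_m) => -[s [[sD sZ] sp]] As /=; rewrite sZ// ler_wpM2l//.
      exact: m_le As.
    move: a0; rewrite [0 <= a]le_eqVlt => /predU1P[<-|a0].
      rewrite mul0r; have := m_le s0 (0 *: v) As0.
      by case: (s0) => s [[sD sZ] sp] /=; rewrite sZ// mul0r.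
    rewrite mulrC -ler_pdivrMr//; apply: (le_m) => s As.
    rewrite ler_pdivrMr// mulrC; apply: (le_trans (m_le _ _ As)).
    by case: (s) => s' [[_ sZ] _] /=; rewrite sZ// ltW.
  have mp v : m v <= p v.
    by apply: (le_trans (m_le _ _ As0)); case: (s0) => ? [? /= ->].
  exists (exist _ m (conj ms mp)) => s As.
  by apply/asboolP => v /=; exact: m_le.
move=> [q [qs qp]] qmin; exists q; split => //.
apply: minimal_sublinear_linear => // r rs rq.
have rp v : r v <= p v := le_trans (rq v) (qp v).
have qr : le (exist _ q (conj qs qp)) (exist _ r (conj rs rp)).
  exact/asboolP.
exact: (congr1 sval (qmin _ qr)).
Qed.

End sublinear.

(** Hahn-Banach for the norm tightened at [y]: a linear functional below it satisfies
    [psi (- y) <= - 1], hence [psi y >= 1]. *)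
Lemma norming_functional (R : realType) (Y : normedModType R) (y : Y) :
  `|y| = 1 -> exists psi : Y -> R, [/\ linear (psi : Y -> R^o),
    (forall v, psi v <= `|v|) & psi y = 1].
Proof.
move=> y1.
have ns : sublinear (fun v : Y => `|v|).
  by split=> [u v|a v a0]; [exact: ler_normD|rewrite normrZ ger0_norm].
have [psi [lpsi psile]] := sublinear_above_linear (sublinear_tightenP y ns).
have psin v : psi v <= `|v|.
  have := sublinear_tighten_le y v ns (lexx 0).
  by rewrite scale0r addr0 mul0r subr0; exact: le_trans.
exists psi; split=> //; apply/eqP; rewrite eq_le -{1}y1 psin/=.
have psiN : psi (- y) = - psi y.
  by have := linear_funZ lpsi (-1) y; rewrite !scaleN1r.
have := sublinear_tighten_le y (- y) ns ler01.
rewrite scale1r addNr normr0 mul1r y1.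
have := psile (- y); rewrite psiN; lra.
Qed.

(** * Isometries between unit spheres *)

Section sphere_isometry.
Context (R : realType) (X Y : normedModType R).

Definition sphere_isometry (f : X -> Y) : Prop :=
  [/\ forall x, `|x| = 1 -> `|f x| = 1,
      forall y, `|y| = 1 -> exists2 x, `|x| = 1 & f x = y &
      forall x y, `|x| = 1 -> `|y| = 1 -> `|f x - f y| = `|x - y|].

(** Oddness of [f] is not known in advance; this companion of [f] turns distances into norms of
    sums. *)
Definition conj_opp (f : X -> Y) (x : X) : Y := - f (- x).

Lemma conj_oppK f : conj_opp (conj_opp f) = f.
Proof. by apply/funext => x; rewrite /conj_opp !opprK. Qed.

Lemma sphere_isometry_opp f : sphere_isometry f -> sphere_isometry (conj_opp f).
Proof.
move=> [f1 fs fi]; split=> [x x1|y y1|x y x1 y1].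
- by rewrite normrN f1// normrN.
- have [|x x1 fx] := fs (- y); first by rewrite normrN.
  by exists (- x); rewrite ?normrN// /conj_opp opprK fx opprK.
- by rewrite -opprD normrN fi ?normrN// -opprD normrN.
Qed.

Lemma sphere_isometry_oppD f x y : sphere_isometry f -> `|x| = 1 -> `|y| = 1 ->
  `|f x + conj_opp f y| = `|x + y|.
Proof. by move=> [_ _ fi] x1 y1; rewrite fi ?normrN// opprK. Qed.

Definition hom_ext (f : X -> Y) (x : X) : Y := `|x| *: f (`|x|^-1 *: x).

Lemma hom_ext1 f x : `|x| = 1 -> hom_ext f x = f x.
Proof. by rewrite /hom_ext => ->; rewrite invr1 !scale1r. Qed.

Lemma hom_extZ f a x : 0 <= a -> hom_ext f (a *: x) = a *: hom_ext f x.
Proof.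
move=> a0; rewrite /hom_ext normrZ (ger0_norm a0) !scalerA.
have [->|an0] := eqVneq a 0; first by rewrite !mul0r !scale0r.
by rewrite invfM [_ * _ * a]mulrC mulrA divff// mul1r.
Qed.

Lemma hom_ext0 f : hom_ext f 0 = 0.
Proof. by rewrite -(scale0r (0 : X)) hom_extZ// scale0r. Qed.

Lemma norm_normalize (V : normedModType R) (x : V) : x != 0 -> `| `|x|^-1 *: x | = 1.
Proof. by move=> x0; rewrite normrZ normfV normr_id mulVf// normr_eq0. Qed.

Lemma hom_ext_norm f x : sphere_isometry f -> `|hom_ext f x| = `|x|.
Proof.
move=> [f1 _ _]; have [->|x0] := eqVneq x 0; first by rewrite hom_ext0 !normr0.
by rewrite normrZ normr_id f1 ?mulr1// norm_normalize.
Qed.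

Lemma extension_of_sphere_duality (f : X -> Y) : sphere_isometry f ->
  (forall z, `|z| = 1 -> exists (psi : Y -> R) (phi : X -> R),
     [/\ linear (psi : Y -> R^o), linear (phi : X -> R^o),
         (forall x, `|x| = 1 -> psi (f x) = phi x) & phi z = 1]) ->
  exists! F : X -> Y, [/\ linear F, set_surj setT setT F, isometry_on setT F
                        & {in @unit_sphere R X, F =1 f}].
Proof.
move=> fiso dual; have [f1 fs fi] := fiso.
(* A nonzero [y] is a positive multiple of some [f z], and the functional attached to [z] does not
   vanish there. Hence a vector killed by all functionals that are linear along [f] is zero; this is
   applied to the linearity defect of [hom_ext f]. *)
have key y : (forall psi : Y -> R, linear (psi : Y -> R^o) ->
    (exists2 phi : X -> R, linear (phi : X -> R^o) &
       forall x, `|x| = 1 -> psi (f x) = phi x) -> psi y = 0) -> y = 0.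
  move=> H; apply/eqP; apply: contraT => y0.
  have [z z1 fz] := fs _ (norm_normalize y0).
  have [psi [phi [lpsi lphi psiphi]]] := dual z z1.
  rewrite -psiphi// fz (linear_funZ lpsi) (H _ lpsi); last by exists phi.
  by rewrite scaler0 => /esym/eqP; rewrite oner_eq0.
have linF : linear (hom_ext f).
  have E (psi : Y -> R) (phi : X -> R) : linear (psi : Y -> R^o) ->
      linear (phi : X -> R^o) ->
      (forall x, `|x| = 1 -> psi (f x) = phi x) -> forall x, psi (hom_ext f x) = phi x.
    move=> lpsi lphi psiphi x; have [->|x0] := eqVneq x 0.
      by rewrite hom_ext0 (linear_fun0 lpsi) (linear_fun0 lphi).
    rewrite (linear_funZ lpsi) psiphi ?norm_normalize// (linear_funZ lphi) scalerA.
    by rewrite divff ?scale1r// normr_eq0.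
  move=> a u v; apply/eqP; rewrite -subr_eq0; apply/eqP/key => psi lpsi [phi lphi pp].
  rewrite (linear_funB lpsi) (linear_funD lpsi) (linear_funZ lpsi a).
  rewrite !(E _ _ lpsi lphi pp).
  rewrite (linear_funD lphi) (linear_funZ lphi).
  exact: subrr.
exists (hom_ext f); split.
  split=> //.
  - move=> y _; have [->|y0] := eqVneq y 0; first by exists 0 => //; exact: hom_ext0.
    have [x x1 fx] := fs _ (norm_normalize y0).
    exists (`|y| *: x) => //=; rewrite hom_extZ// hom_ext1// fx scalerA.
    by rewrite divff ?scale1r// normr_eq0.
  - move=> x y _ _; rewrite -(linear_funB linF); exact: hom_ext_norm.
  - by move=> x /set_mem x1; exact: hom_ext1.
move=> F [linF' _ _ Ff]; apply/funext => x.
have [->|x0] := eqVneq x 0; first by rewrite hom_ext0 (linear_fun0 linF').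
rewrite /hom_ext -Ff ?(linear_funZ linF') ?scalerA ?divff ?scale1r ?normr_eq0//.
by apply/mem_set; exact: norm_normalize.
Qed.

End sphere_isometry.

Lemma mazur_ulam_property_dual (R : realType) (X : normedModType R) :
  (forall (Y : normedModType R) (f : X -> Y), sphere_isometry f ->
   forall z, `|z| = 1 -> exists (psi : Y -> R) (phi : X -> R),
     [/\ linear (psi : Y -> R^o), linear (phi : X -> R^o),
         (forall x, `|x| = 1 -> psi (f x) = phi x) & phi z = 1]) ->
  mazur_ulam_property X.
Proof.
move=> dual Y f ff fs fi.
have fiso : sphere_isometry f.
  split=> [x /ff//|y /fs[x x1 <-]|x y x1 y1]; first by exists x.
  exact: fi.
exact: (extension_of_sphere_duality fiso (dual _ _ fiso)).
Qed.

(** * Additivity of the norm on cones of aligned vectors *)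

Section flat_pieces.
Context (R : realType) (Y : normedModType R).
Implicit Types (a b c d : Y) (r s t u : R).

(** With [s <= t], the vector is [t *: (a + b)] minus [(t - s) *: a], and the reverse triangle
    inequality gives the sharp lower bound. *)
Lemma flat2 a b s t : `|a| <= 1 -> `|b| <= 1 -> `|a + b| = 2 ->
  0 <= s -> 0 <= t -> `|s *: a + t *: b| = s + t.
Proof.
move=> a1 b1 ab; wlog st : a b s t a1 b1 ab / s <= t => [H|] s0 t0.
  have [st|/ltW ts] := leP s t; first exact: H.
  by rewrite addrC [RHS]addrC; apply: H; rewrite // addrC.
apply/eqP; rewrite eq_le; apply/andP; split.
  rewrite (le_trans (ler_normD _ _))// !normrZ !ger0_norm//.
  by apply: lerD; rewrite ler_piMr.
have -> : s *: a + t *: b = t *: (a + b) - (t - s) *: a.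
  by rewrite scalerDr scalerBl opprB [RHS]addrC addrA subrK.
have := lerB_dist (t *: (a + b)) ((t - s) *: a).
rewrite !normrZ ab !ger0_norm ?subr_ge0//.
have := normr_ge0 a; nra.
Qed.

(** The middle coefficient dominates, so the vector is [t] times the full sum minus nonnegative
    multiples of [a] and [c]. *)
Lemma flat3 a b c s t u : `|a| <= 1 -> `|b| <= 1 -> `|c| <= 1 ->
  `|a + b + c| = 3 -> 0 <= s <= t -> 0 <= u <= t ->
  `|s *: a + t *: b + u *: c| = s + t + u.
Proof.
move=> a1 b1 c1 abc /andP[s0 st] /andP[u0 ut].
have t0 := le_trans s0 st.
apply/eqP; rewrite eq_le; apply/andP; split.
  rewrite (le_trans (ler_normD _ _))// lerD//; last first.
    by rewrite normrZ ger0_norm// ler_piMr.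
  rewrite (le_trans (ler_normD _ _))// !normrZ !ger0_norm//.
  by apply: lerD; rewrite ler_piMr.
have -> : s *: a + t *: b + u *: c =
    t *: (a + b + c) - ((t - s) *: a + (t - u) *: c).
  rewrite !scalerDr !scalerBl opprD !opprB addrACA; congr (_ + _).
    by rewrite [RHS]addrC addrA subrK.
  by rewrite addrC subrK.
have := lerB_dist (t *: (a + b + c)) ((t - s) *: a + (t - u) *: c).
have := ler_normD ((t - s) *: a) ((t - u) *: c).
rewrite !normrZ abc !ger0_norm ?subr_ge0//.
have := normr_ge0 a; have := normr_ge0 c; nra.
Qed.

End flat_pieces.

(** * Images of a face that is the star of one of its points *)

Section star.
Context (R : realType) (X Y : normedModType R).
Variables (F : set X) (g : X).
Hypotheses (F1 : forall x, F x -> `|x| = 1) (Fg : F g)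
  (FD : forall x y, F x -> F y -> `|x + y| = 2)
  (gF : forall x, `|x| = 1 -> `|x + g| = 2 -> F x).

(** By [gF], points of [F] are recognised by their distance 2 to [- g], and [f] preserves
    distances. *)
Lemma star_preimage (f : X -> Y) y : sphere_isometry f ->
  `|y| = 1 -> `|y + conj_opp f g| = 2 -> exists2 c, F c & f c = y.
Proof.
move=> fiso y1 yg; have [f1 fs fi] := fiso.
have [c c1 fc] := fs _ y1; exists c => //; apply: gF => //.
by rewrite -(sphere_isometry_oppD fiso c1 (F1 Fg)) fc.
Qed.

Lemma star_flat2 (f : X -> Y) x y : sphere_isometry f -> F x -> F y ->
  `|f x + conj_opp f y| = 2.
Proof.
by move=> fiso Fx Fy; rewrite (sphere_isometry_oppD fiso) ?FD//; exact: F1.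
Qed.

(* From [x] one obtains the point of [F] over the barycentre of [f x] and
   [conj_opp f g], whose distance to [F] is again known. *)
Lemma star_flat3 (f : X -> Y) x y : sphere_isometry f -> F x -> F y ->
  `|f x + conj_opp f g + conj_opp f y| = 3.
Proof.
move=> fiso Fx Fy; have [f1 _ _] := fiso.
have [f1' _ _] := sphere_isometry_opp fiso.
have n1 z : F z -> `|f z| <= 1 by move=> Fz; rewrite f1// F1.
have n1' z : F z -> `|conj_opp f z| <= 1 by move=> Fz; rewrite f1'// F1.
have xg := flat2 (n1 _ Fx) (n1' _ Fg) (star_flat2 fiso Fx Fg).
pose w := 2^-1 *: f x + 2^-1 *: conj_opp f g.
have w1 : `|w| = 1 by rewrite xg; lra.
have [|c Fc cw] := star_preimage fiso w1.
  rewrite /w -addrA -[X in _ + (_ + X)]scale1r -scalerDl xg; lra.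
have := flat2 (n1 _ Fc) (n1' _ Fy) (star_flat2 fiso Fc Fy) (ler0n R 2) ler01.
rewrite cw /w scalerDr !scalerA divff ?pnatr_eq0// !scale1r => ->.
lra.
Qed.

(** The device of [star_flat3] again, now at the barycentre of three vectors; the weight 3 clears
    its denominators. *)
Lemma star_flat4 (f : X -> Y) x y z : sphere_isometry f ->
  F x -> F y -> F z ->
  `|f x + conj_opp f g + conj_opp f y + 3 *: conj_opp f z| = 6.
Proof.
move=> fiso Fx Fy Fz; have [f1 _ _] := fiso.
have [f1' _ _] := sphere_isometry_opp fiso.
have n1 v : F v -> `|f v| <= 1 by move=> Fv; rewrite f1// F1.
have n1' v : F v -> `|conj_opp f v| <= 1 by move=> Fv; rewrite f1'// F1.
have xgy := flat3 (n1 _ Fx) (n1' _ Fg) (n1' _ Fy) (star_flat3 fiso Fx Fy).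
pose w := 3^-1 *: f x + 3^-1 *: conj_opp f g + 3^-1 *: conj_opp f y.
have w1 : `|w| = 1 by rewrite xgy; lra.
have [|c Fc cw] := star_preimage fiso w1.
  rewrite /w addrAC -[X in _ + _ + X + _]scale1r -[_ + _ + 1 *: _]addrA -scalerDl.
  rewrite xgy; lra.
have := flat2 (n1 _ Fc) (n1' _ Fz) (star_flat2 fiso Fc Fz) (ler0n R 3) (ler0n R 3).
rewrite cw /w !scalerDr !scalerA divff ?pnatr_eq0// !scale1r => ->.
lra.
Qed.

(** By [star_preimage] it suffices that the combination is aligned with [conj_opp f g]; [flat3]
    gives this once [f x], [conj_opp f g] and [f y] are aligned. *)
Lemma star_convex (f : X -> Y) x y t : sphere_isometry f -> F x -> F y ->
  0 <= t <= 1 -> exists2 c, F c & f c = (1 - t) *: f x + t *: f y.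
Proof.
move=> fiso Fx Fy /andP[t0 t1]; have [f1 _ _] := fiso.
have fiso' := sphere_isometry_opp fiso.
have [f1' _ _] := fiso'.
have n1 v : F v -> `|f v| <= 1 by move=> Fv; rewrite f1// F1.
have n1' v : F v -> `|conj_opp f v| <= 1 by move=> Fv; rewrite f1'// F1.
have h3 : `|f x + conj_opp f g + f y| = 3.
  apply/eqP; rewrite eq_le; apply/andP; split.
    rewrite (le_trans (ler_normD _ _))// (le_trans (lerD (ler_normD _ _) (lexx _)))//.
    have := n1 _ Fx; have := n1' _ Fg; have := n1 _ Fy; lra.
  (* Passing to [conj_opp f] exchanges the roles of [f] and [conj_opp f]. Removing [f g + 2 *: f y],
     of norm at most 3, from a vector of norm 6 leaves norm at least 3. *)
  have := star_flat4 fiso' Fg Fx Fy; rewrite conj_oppK => h6.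
  have := ler_normD (f x + conj_opp f g + f y) (f g + 2 *: f y).
  have -> : f x + conj_opp f g + f y + (f g + 2 *: f y) =
      conj_opp f g + f g + f x + 3 *: f y.
    have -> : 3 *: f y = f y + 2 *: f y.
      by rewrite -[X in X + _]scale1r -scalerDl; congr (_ *: _); lra.
    by rewrite addrACA; congr (_ + _); rewrite [RHS]addrC addrA.
  rewrite h6; have := ler_normD (f g) (2 *: f y).
  rewrite normrZ ger0_norm//; have := n1 _ Fg; have := n1 _ Fy; lra.
have /(_ (1 - t) 1 t) := flat3 (n1 _ Fx) (n1' _ Fg) (n1 _ Fy) h3.
rewrite scale1r addrAC => h2.
have {}h2 : `|(1 - t) *: f x + t *: f y + conj_opp f g| = 2.
  by rewrite h2; lra.
apply: star_preimage => //.
apply/eqP; rewrite eq_le; apply/andP; split.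
  rewrite (le_trans (ler_normD _ _))// !normrZ !ger0_norm ?subr_ge0//.
  have := n1 _ Fx; have := n1 _ Fy; nra.
have := ler_normD ((1 - t) *: f x + t *: f y) (conj_opp f g).
rewrite h2; have := n1' _ Fg; lra.
Qed.

(** In the aligned triple of [star_flat3] for [g] and [x], dropping [f g] costs at most 1, so
    [conj_opp f x] and [conj_opp f g] are aligned. *)
Lemma star_opp (f : X -> Y) x : sphere_isometry f -> F x ->
  exists2 c, F c & f c = conj_opp f x.
Proof.
move=> fiso Fx; have [f1' _ _] := sphere_isometry_opp fiso.
apply: star_preimage => //; first by rewrite f1'// F1.
have := star_flat3 fiso Fg Fx; rewrite -addrA [conj_opp f g + _]addrC => h3.
apply/eqP; rewrite eq_le; apply/andP; split.
  by rewrite (le_trans (ler_normD _ _))// !f1' ?F1//; lra.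
have := ler_normD (f g) (conj_opp f x + conj_opp f g).
by have [f1 _ _] := fiso; rewrite h3 f1 ?F1//; lra.
Qed.

End star.

(** * Spheres of inner product spaces *)

Section inner_product.
Context (R : realType) (X Y : normedModType R) (ip : X -> X -> R).
Hypotheses (ipC : forall x y, ip x y = ip y x)
  (ipD : forall x y z, ip (x + y) z = ip x z + ip y z)
  (ipZ : forall a x z, ip (a *: x) z = a * ip x z)
  (ip_norm : forall x, ip x x = `|x| ^+ 2).

Let ipN x y : ip (- x) y = - ip x y.
Proof. by rewrite -scaleN1r ipZ mulN1r. Qed.

Let normD2 x y : `|x + y| ^+ 2 = `|x| ^+ 2 + 2 * ip x y + `|y| ^+ 2.
Proof.
rewrite -!ip_norm ipD [ip x _]ipC [ip y (x + y)]ipC !ipD [ip y x]ipC; lra.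
Qed.

Let normB2 x y : `|x - y| ^+ 2 = `|x| ^+ 2 - 2 * ip x y + `|y| ^+ 2.
Proof. by rewrite normD2 [ip x _]ipC ipN normrN [ip y x]ipC mulrN. Qed.

Let eq_of_norm2 (x y : X) : `|x| = 1 -> `|y| = 1 -> `|x + y| = 2 -> x = y.
Proof.
move=> x1 y1 xy; apply/eqP; rewrite -subr_eq0 -normr_eq0 -sqrf_eq0 normB2.
have := normD2 x y; rewrite xy x1 y1 => ?; apply/eqP; lra.
Qed.

Variable f : X -> Y.
Hypothesis fiso : sphere_isometry f.

(** The preimage of [- f x] is at distance 2 from [x]; strict convexity leaves only [- x]. *)
Let f_opp (x : X) : `|x| = 1 -> f (- x) = - f x.
Proof.
move=> x1; have [f1 fs fi] := fiso.
have [|y y1 fy] := fs (- f x); first by rewrite normrN f1.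
rewrite -fy; congr f; apply/esym/eq_of_norm2; rewrite ?normrN//.
rewrite -fi// fy -opprD normrN -mulr2n normrMn f1//.
Qed.

Let f_add (x y : X) : `|x| = 1 -> `|y| = 1 -> `|f x + f y| = `|x + y|.
Proof.
have [f1 fs fi] := fiso.
by move=> x1 y1; rewrite -[f y]opprK -f_opp// fi ?normrN// opprK.
Qed.

(* With [N = |a + m| = |b + m|], the points [p] and [q] of the sphere lying over
   [(f a + f m) / N] and [(f b + f m) / N] satisfy [N |p - q| = |a - b|], so that
   the parallelogram law yields [|p + q| = N]. Hence [f a + f b + 2 f m] has norm
   [N ^ 2 = |a + b| + 2], which forces [f m] to be aligned with [f a + f b]. *)
Let f_midpoint (a b : X) : `|a| = 1 -> `|b| = 1 -> a + b != 0 ->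
  f a + f b = `|a + b| *: f (`|a + b|^-1 *: (a + b)).
Proof.
move=> a1 b1 ab0; have [f1 fs fi] := fiso.
set n := `|a + b|; set m := n^-1 *: (a + b).
have n0 : 0 < n by rewrite normr_gt0.
have m1 : `|m| = 1 by exact: norm_normalize.
have n2 : n <= 2 by rewrite (le_trans (ler_normD _ _))// a1 b1; lra.
have nk : n ^+ 2 = 2 + 2 * ip a b by rewrite /n normD2 a1 b1; lra.
have iam : ip a m = n / 2.
  rewrite ipC ipZ ipD ip_norm a1 [ip b a]ipC.
  have -> : 1 ^+ 2 + ip a b = n ^+ 2 / 2 by rewrite nk; lra.
  by field; rewrite gt_eqF.
have ibm : ip b m = n / 2.
  rewrite ipC ipZ ipD ip_norm b1.
  have -> : ip a b + 1 ^+ 2 = n ^+ 2 / 2 by rewrite nk; lra.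
  by field; rewrite gt_eqF.
pose N := Num.sqrt (2 + n).
have N0 : 0 < N by rewrite sqrtr_gt0; lra.
have N2 : N ^+ 2 = 2 + n by rewrite sqr_sqrtr//; lra.
have sqE r s : 0 <= r -> 0 < s -> r ^+ 2 = s ^+ 2 -> r = s.
  move=> r0 s0 rs; apply/eqP; rewrite -(eqrXn2 (n := 2))// ?rs//.
  exact: ltW.
have am : `|a + m| = N.
  by apply: sqE => //; rewrite normD2 a1 m1 iam N2; lra.
have bm : `|b + m| = N.
  by apply: sqE => //; rewrite normD2 b1 m1 ibm N2; lra.
have [|p p1 fp] := fs (N^-1 *: (f a + f m)).
  by rewrite normrZ f_add// am gtr0_norm ?invr_gt0// mulVf// gt_eqF.
have [|q q1 fq] := fs (N^-1 *: (f b + f m)).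
  by rewrite normrZ f_add// bm gtr0_norm ?invr_gt0// mulVf// gt_eqF.
have [|c c1 fc] := fs (n^-1 *: (f a + f b)).
  by rewrite normrZ f_add// gtr0_norm ?invr_gt0// mulVf// gt_eqF.
have pq : `|p - q| = N^-1 * `|a - b|.
  rewrite -fi// fp fq -scalerBr opprD addrACA subrr addr0 normrZ fi//.
  by rewrite gtr0_norm ?invr_gt0.
have pqN : `|p + q| = N.
  apply: sqE => //; have := normB2 p q; rewrite pq exprMn normB2 p1 q1 a1 b1.
  rewrite normD2 p1 q1 N2 exprVn N2.
  have -> : 1 ^+ 2 - 2 * ip a b + 1 ^+ 2 = (2 + n) * (2 - n) by move: nk; lra.
  rewrite mulKf; first lra.
  by apply/eqP; lra.
have fcm : `|n *: f c + 2 *: f m| = n + 2.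
  rewrite fc scalerA divff ?gt_eqF// scale1r.
  have -> : f a + f b + 2 *: f m = N *: (f p + f q).
    rewrite fp fq scalerDr !scalerA divff ?gt_eqF// !scale1r addrACA.
    by rewrite -[2]/(1 + 1) scalerDl scale1r.
  by rewrite normrZ f_add// pqN gtr0_norm// -expr2 N2 addrC.
have cm : `|c + m| = 2.
  rewrite -f_add//; apply/eqP; rewrite eq_le; apply/andP; split.
    by rewrite (le_trans (ler_normD _ _))// !f1//; lra.
  rewrite -(ler_pM2l n0) -{2}(gtr0_norm n0) -normrZ.
  have := lerB_dist (n *: f c + 2 *: f m) ((2 - n) *: f m).
  rewrite fcm.
  rewrite [ `|(2 - n) *: _|]normrZ f1// mulr1 ger0_norm ?subr_ge0//.
  have -> : n *: f c + 2 *: f m - (2 - n) *: f m = n *: (f c + f m).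
    by rewrite -addrA -scalerBl opprB addrCA subrr addr0 scalerDr.
  lra.
by rewrite -(eq_of_norm2 c1 m1 cm) fc scalerA divff ?scale1r// gt_eqF.
Qed.

Let f_aligned (a b z : X) c : `|a| = 1 -> `|b| = 1 -> `|z| = 1 -> a + b = c *: z ->
  f a + f b = c *: f z.
Proof.
move=> a1 b1 z1 abc.
have [c0|c0|c0] := ltgtP c 0.
- have ab : `|a + b| = - c by rewrite abc normrZ z1 mulr1 ltr0_norm.
  rewrite f_midpoint//; last by rewrite -normr_gt0 ab oppr_gt0.
  rewrite ab abc scalerA invrN mulNr mulVf ?lt_eqF// scaleN1r f_opp//.
  by rewrite scalerN scaleNr opprK.
- have ab : `|a + b| = c by rewrite abc normrZ z1 mulr1 gtr0_norm.
  rewrite f_midpoint//; last by rewrite -normr_gt0 ab.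
  by rewrite ab abc scalerA mulVf ?gt_eqF// scale1r.
- move: abc; rewrite c0 !scale0r => /eqP; rewrite addr_eq0 => /eqP ->.
  by rewrite f_opp// addNr.
Qed.

Let norm_orthogonal (z u : X) c s : `|z| = 1 -> `|u| = 1 -> ip z u = 0 ->
  c ^+ 2 + s ^+ 2 = 1 -> `|c *: z + s *: u| = 1.
Proof.
move=> z1 u1 zu cs; apply/eqP; rewrite -(eqrXn2 (n := 2))// normD2.
rewrite !normrZ z1 u1 !mulr1 -![ `|_| ^+ 2]normrX !ger0_norm ?sqr_ge0//.
rewrite ipZ [ip z _]ipC ipZ [ip u z]ipC zu; apply/eqP; lra.
Qed.

(** The point [x = c z + s u] and its reflection [w = c z - s u] satisfy [x + w = 2 c z] and
    [x - w = 2 s u]; adding the two resulting identities isolates [f x]. *)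
Let f_orthogonal (z u : X) c s : `|z| = 1 -> `|u| = 1 -> ip z u = 0 ->
  c ^+ 2 + s ^+ 2 = 1 -> f (c *: z + s *: u) = c *: f z + s *: f u.
Proof.
move=> z1 u1 zu cs.
have x1 := norm_orthogonal z1 u1 zu cs.
have w1 : `|c *: z + - s *: u| = 1 by apply: norm_orthogonal; rewrite ?sqrrN.
have e1 := f_aligned (c := 2 * c) x1 w1 z1.
have w1' : `|- (c *: z + - s *: u)| = 1 by rewrite normrN.
have e2 := f_aligned (c := 2 * s) x1 w1' u1.
move: e1 e2; rewrite f_opp// => e1 e2.
apply: (@scalerI _ _ (2 : R)); first by rewrite pnatr_eq0.
rewrite scalerDr !scalerA -e1 -?e2.
- by rewrite addrACA subrr addr0 -[2]/(1 + 1) scalerDl scale1r.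
- by rewrite opprD addrACA subrr add0r scaleNr opprK -scalerDl; congr (_ *: _); lra.
- by rewrite scaleNr addrACA subrr addr0 -scalerDl; congr (_ *: _); lra.
Qed.

Lemma inner_product_sphere_dual (z : X) : `|z| = 1 ->
  exists (psi : Y -> R) (phi : X -> R),
     [/\ linear (psi : Y -> R^o), linear (phi : X -> R^o),
         (forall x, `|x| = 1 -> psi (f x) = phi x) & phi z = 1].
Proof.
move=> z1; have [f1 fs fi] := fiso.
have [psi [lpsi psin psiz]] := norming_functional (f1 _ z1).
exists psi, (ip ^~ z); split=> //; last by rewrite ip_norm z1 expr1n.
  by move=> a u v; rewrite ipD ipZ.
have orth u : `|u| = 1 -> ip z u = 0 -> psi (f u) = 0.
  move=> u1 zu; set G := psi (f u).
  (* This is the norm of [z + G *: u]. On the image of the normalised vector [psi] takes the value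
     [n], so [n <= 1] and [G = 0]. *)
  pose n := Num.sqrt (1 + G ^+ 2).
  have n2 : n ^+ 2 = 1 + G ^+ 2 by rewrite sqr_sqrtr// addr_ge0// sqr_ge0.
  have n0 : 0 < n by rewrite sqrtr_gt0 ltr_pwDl// sqr_ge0.
  have cs : n^-1 ^+ 2 + (G / n) ^+ 2 = 1.
    by rewrite exprMn -{1}[_ ^+ 2]mul1r -mulrDl -n2 -exprMn divff ?gt_eqF// expr1n.
  have := psin (f (n^-1 *: z + (G / n) *: u)).
  rewrite f1 ?norm_orthogonal// f_orthogonal//.
  rewrite (linear_funD lpsi) !(linear_funZ lpsi) psiz -/G.
  rewrite [_ + _](_ : _ = n^-1 * (1 + G ^+ 2)); last first.
    by rewrite /GRing.scale/= mulr1 expr2; lra.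
  rewrite -n2 expr2 mulrA mulVf ?gt_eqF// mul1r => n1.
  have : G ^+ 2 <= 0 by move: n2; rewrite expr2; nra.
  by move=> G0; apply/eqP; rewrite -sqrf_eq0 eq_le G0 sqr_ge0.
move=> x x1; set c := ip x z.
have s2 : `|x - c *: z| ^+ 2 = 1 - c ^+ 2.
  rewrite normB2 x1 normrZ z1 mulr1 real_normK ?num_real//.
  rewrite ipC ipZ [ip z x]ipC -/c; lra.
(* If the component of [x] orthogonal to [z] vanishes, then [x] is [z] or [- z]; otherwise it is
   normalised and [f_orthogonal] applies. *)
have [h0|h0] := eqVneq (x - c *: z) 0.
  move: s2; rewrite h0 normr0 expr0n/= => /esym/eqP; rewrite subr_eq0 eq_sym.
  move/eqP: h0; rewrite subr_eq0 => /eqP {1}->; rewrite sqrf_eq1.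
  by move=> /orP[] /eqP ->; rewrite ?scaleN1r ?f_opp// ?(linear_funN lpsi) ?scale1r psiz.
have E : x = c *: z + `|x - c *: z| *: (`|x - c *: z|^-1 *: (x - c *: z)).
  by rewrite scalerA divff ?normr_eq0// scale1r addrC subrK.
have zh : ip z (`|x - c *: z|^-1 *: (x - c *: z)) = 0.
  by rewrite ipC ipZ ipD ipN ipZ ip_norm z1 expr1n mulr1 subrr mulr0.
have h1 := norm_normalize h0.
rewrite {1}E f_orthogonal// ?s2; last lra.
rewrite (linear_funD lpsi) !(linear_funZ lpsi) psiz orth//.
by rewrite /GRing.scale/= mulr0 addr0 mulr1.
Qed.

End inner_product.

(** * Hilbert spaces and compact operators *)

Definition cabs (R : realType) (a : R[i]) : R := complex.Re `|a|.

Section complex_hilbert.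
Context (R : realType) (H : completeNormedModType R[i]).
Variable dot : {dot H for conjC}.
Hypothesis dot_norm : forall x : H, dot x x = `|x| ^+ 2.
Implicit Types (u v w x y z : H) (a b c : R[i]).

Lemma cabsE a : (cabs a)%:C = `|a|.
Proof. by rewrite /cabs RRe_real// ger0_real. Qed.

Lemma dotDl u v w : dot (u + v) w = dot u w + dot v w.
Proof. exact: linearDl. Qed.
Lemma dotDr u v w : dot w (u + v) = dot w u + dot w v.
Proof. exact: linearDr. Qed.
Lemma dotNl u w : dot (- u) w = - dot u w.
Proof. exact: linearNl. Qed.
Lemma dotNr u w : dot w (- u) = - dot w u.
Proof. exact: linearNr. Qed.
Lemma dotZl a u w : dot (a *: u) w = a * dot u w.
Proof. exact: linearZl_LR. Qed.
Lemma dotZr a u w : dot w (a *: u) = a^* * dot w u.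
Proof. by rewrite linearZr_LR. Qed.
Lemma dot0l w : dot 0 w = 0.
Proof. exact: linear0l. Qed.
Lemma dot0r w : dot w 0 = 0.
Proof. exact: linear0r. Qed.
Lemma dotC u v : dot u v = (dot v u)^*.
Proof. by rewrite (hermC dot) expr0 mul1r. Qed.
Lemma dot_eq0C u v : dot u v = 0 -> dot v u = 0.
Proof. by move=> uv; rewrite dotC uv rmorph0. Qed.

Definition redot u v : R := complex.Re (dot u v).

Lemma redotC u v : redot u v = redot v u.
Proof. by rewrite /redot dotC; case: (dot v u). Qed.
Lemma redotDl u v w : redot (u + v) w = redot u w + redot v w.
Proof. by rewrite /redot dotDl raddfD. Qed.
Lemma redotDr u v w : redot w (u + v) = redot w u + redot w v.
Proof. by rewrite /redot dotDr raddfD. Qed.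
Lemma redotNl u w : redot (- u) w = - redot u w.
Proof. by rewrite /redot dotNl raddfN. Qed.
Lemma redotNr u w : redot w (- u) = - redot w u.
Proof. by rewrite /redot dotNr raddfN. Qed.
Lemma redotZl (r : R) u w : redot (r%:C *: u) w = r * redot u w.
Proof. by rewrite /redot dotZl; case: (dot u w) => ? ? /=; rewrite mul0r subr0. Qed.
Lemma redotZr (r : R) u w : redot w (r%:C *: u) = r * redot w u.
Proof. by rewrite redotC redotZl redotC. Qed.

Lemma dotvv x : dot x x = (rnorm x ^+ 2)%:C.
Proof. by rewrite dot_norm -rnormE rmorphXn. Qed.
Lemma redotvv x : redot x x = rnorm x ^+ 2.
Proof. by rewrite /redot dotvv. Qed.

Lemma rnorm_ge0 (V : normedModType R[i]) (x : V) : 0 <= rnorm x.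
Proof. by rewrite -lecR rnormE; exact: normr_ge0. Qed.
Lemma rnormZ (V : normedModType R[i]) a (x : V) : rnorm (a *: x) = cabs a * rnorm x.
Proof. by apply: complexI; rewrite rmorphM/= !rnormE normrZ cabsE. Qed.
Lemma rnormN (V : normedModType R[i]) (x : V) : rnorm (- x) = rnorm x.
Proof. by rewrite /rnorm normrN. Qed.
Lemma rnormB (V : normedModType R[i]) (x y : V) : rnorm (x - y) = rnorm (y - x).
Proof. by rewrite /rnorm distrC. Qed.
Lemma rnormD (V : normedModType R[i]) (x y : V) : rnorm (x + y) <= rnorm x + rnorm y.
Proof. by rewrite -lecR rmorphD/= !rnormE ler_normD. Qed.
Lemma rnorm0 (V : normedModType R[i]) : rnorm (0 : V) = 0.
Proof. by rewrite /rnorm normr0. Qed.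
Lemma rnorm_eq0 (V : normedModType R[i]) (x : V) : (rnorm x == 0) = (x == 0).
Proof. by rewrite -(inj_eq (@complexI _)) rnormE normr_eq0. Qed.
Lemma cabs_ge0 a : 0 <= cabs a.
Proof. by rewrite -lecR cabsE; exact: normr_ge0. Qed.
Lemma cabsM a b : cabs (a * b) = cabs a * cabs b.
Proof. by apply: complexI; rewrite rmorphM/= !cabsE normrM. Qed.
Lemma cabsR (r : R) : cabs r%:C = `|r|.
Proof. by apply: complexI; rewrite cabsE normcR. Qed.
Lemma cabsN a : cabs (- a) = cabs a.
Proof. by rewrite /cabs normrN. Qed.
Lemma cabsB a b : cabs (a - b) = cabs (b - a).
Proof. by rewrite /cabs distrC. Qed.
Lemma cabs_conj a : cabs a^* = cabs a.
Proof. by rewrite /cabs norm_conjC. Qed.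
Lemma conjCR (r : R) : conjC r%:C = r%:C.
Proof. exact: conjc_real. Qed.
Lemma cabs0 : cabs (0 : R[i]) = 0.
Proof. by rewrite /cabs normr0. Qed.
Lemma cabs1 : cabs (1 : R[i]) = 1.
Proof. by rewrite /cabs normr1. Qed.
Lemma cabs_eq0 a : (cabs a == 0) = (a == 0).
Proof. by rewrite -(inj_eq (@complexI _)) cabsE normr_eq0. Qed.
Lemma cabs2 a : a * a^* = (cabs a ^+ 2)%:C.
Proof. by rewrite -normCK rmorphXn/= cabsE. Qed.
Lemma cabsD a b : cabs (a + b) <= cabs a + cabs b.
Proof. by rewrite -lecR rmorphD/= !cabsE ler_normD. Qed.
Lemma ge_Re_cabs a : complex.Re a <= cabs a.
Proof.
rewrite /cabs normc_def/=; case: a => r s /=.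
by rewrite (le_trans (ler_norm _))// -sqrtr_sqr ler_wsqrtr// lerDl sqr_ge0.
Qed.

Lemma rnorm2D x y : rnorm (x + y) ^+ 2 = rnorm x ^+ 2 + rnorm y ^+ 2 + 2 * redot x y.
Proof. by rewrite -!redotvv redotDl !redotDr [redot y x]redotC; lra. Qed.

Lemma rnorm2B x y : rnorm (x - y) ^+ 2 = rnorm x ^+ 2 + rnorm y ^+ 2 - 2 * redot x y.
Proof. by rewrite rnorm2D rnormN redotNr mulrN. Qed.

Lemma pythagoras x y : dot x y = 0 -> rnorm (x + y) ^+ 2 = rnorm x ^+ 2 + rnorm y ^+ 2.
Proof. by move=> xy; rewrite rnorm2D /redot xy mulr0 addr0. Qed.

Lemma rnorm1_dot x : rnorm x = 1 -> dot x x = 1.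
Proof. by move=> x1; rewrite dotvv x1 expr1n. Qed.

Lemma dot_proj x v : rnorm x = 1 -> dot (v - dot v x *: x) x = 0.
Proof. by move=> x1; rewrite dotDl dotNl dotZl rnorm1_dot// mulr1 subrr. Qed.

Lemma rnorm2_proj x v : rnorm x = 1 ->
  rnorm v ^+ 2 = cabs (dot v x) ^+ 2 + rnorm (v - dot v x *: x) ^+ 2.
Proof.
move=> x1; have E : v = dot v x *: x + (v - dot v x *: x) by rewrite addrC subrK.
have o : dot (dot v x *: x) (v - dot v x *: x) = 0.
  by rewrite dotZl (dot_eq0C (dot_proj v x1)) mulr0.
by have := pythagoras o; rewrite -E => ->; rewrite rnormZ x1 mulr1.
Qed.

Lemma cauchy_schwarz1 x v : rnorm x = 1 -> cabs (dot v x) <= rnorm v.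
Proof.
move=> x1; rewrite -(ler_pXn2r (n := 2)) ?nnegrE ?cabs_ge0 ?rnorm_ge0//.
by rewrite (rnorm2_proj v x1) lerDl sqr_ge0.
Qed.

Lemma rnorm_normalize x : x != 0 -> rnorm ((rnorm x)^-1%:C *: x) = 1.
Proof.
by move=> x0; rewrite rnormZ cabsR ger0_norm ?invr_ge0 ?rnorm_ge0// mulVf ?rnorm_eq0.
Qed.

Lemma cauchy_schwarz x v : cabs (dot v x) <= rnorm v * rnorm x.
Proof.
have [->|x0] := eqVneq x 0; first by rewrite dot0r cabs0 rnorm0 mulr0.
have := cauchy_schwarz1 v (rnorm_normalize x0).
rewrite dotZr cabsM cabs_conj cabsR ger0_norm ?invr_ge0 ?rnorm_ge0//.
by rewrite mulrC ler_pdivrMr// lt_neqAle eq_sym rnorm_eq0 x0 rnorm_ge0.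
Qed.

Lemma redot_le x y : redot x y <= rnorm x * rnorm y.
Proof. exact: le_trans (ge_Re_cabs _) (cauchy_schwarz _ _). Qed.

(** Stewart's identity expresses the squared distance from [v] to a point of the segment through
    those to [p] and [q]; the two bounds make it nonpositive. *)
Lemma chord_point (p q v : H) (c : R) : 0 <= c <= 1 ->
  rnorm (v - p) <= c * rnorm (p - q) -> rnorm (v - q) <= (1 - c) * rnorm (p - q) ->
  v = (1 - c)%:C *: p + c%:C *: q.
Proof.
move=> /andP[c0 c1] vp vq; apply/eqP; rewrite -subr_eq0 -rnorm_eq0 -sqrf_eq0.
have vp2 : rnorm (v - p) ^+ 2 <= (c * rnorm (p - q)) ^+ 2.
  by rewrite ler_pXn2r// nnegrE ?mulr_ge0 ?rnorm_ge0.
have vq2 : rnorm (v - q) ^+ 2 <= ((1 - c) * rnorm (p - q)) ^+ 2.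
  by rewrite ler_pXn2r// nnegrE ?mulr_ge0 ?rnorm_ge0// subr_ge0.
rewrite eq_le sqr_ge0 andbT.
have -> : rnorm (v - ((1 - c)%:C *: p + c%:C *: q)) ^+ 2 =
    (1 - c) * rnorm (v - p) ^+ 2 + c * rnorm (v - q) ^+ 2
    - c * (1 - c) * rnorm (p - q) ^+ 2.
  rewrite -!redotvv !(redotDl, redotDr, redotNl, redotNr, redotZl, redotZr).
  by rewrite [redot p v]redotC [redot q v]redotC [redot q p]redotC; ring.
move: vp2 vq2; rewrite !exprMn; have := sqr_ge0 (rnorm (p - q)); nra.
Qed.

(** * Compact operators as a real normed space *)

Local Notation X := (realification (compact_op H)).
Implicit Types (S T : X).

Definition ap T v : H := (T : compact_op H) v.

Lemma apD S T v : ap (S + T) v = ap S v + ap T v.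
Proof. by []. Qed.
Lemma apN T v : ap (- T) v = - ap T v.
Proof. by []. Qed.
Lemma apB S T v : ap (S - T) v = ap S v - ap T v.
Proof. by []. Qed.
Lemma apZ (r : R) T v : ap (r *: T) v = r%:C *: ap T v.
Proof. by []. Qed.
Lemma ap_sum (I : Type) (s : seq I) (P : pred I) (F : I -> X) v :
  ap (\sum_(i <- s | P i) F i) v = \sum_(i <- s | P i) ap (F i) v.
Proof. by apply: (big_morph (ap^~ v)). Qed.
Lemma ap_linear T : linear (ap T).
Proof. by have [] := compact_opP (T : compact_op H). Qed.
Lemma apvD T u v : ap T (u + v) = ap T u + ap T v.
Proof. exact: linear_funD (ap_linear T) _ _. Qed.
Lemma apvB T u v : ap T (u - v) = ap T u - ap T v.
Proof. exact: linear_funB (ap_linear T) _ _. Qed.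
Lemma apvZ T a v : ap T (a *: v) = a *: ap T v.
Proof. exact: linear_funZ (ap_linear T) _ _. Qed.
Lemma apv0 T : ap T 0 = 0.
Proof. exact: linear_fun0 (ap_linear T). Qed.
Lemma apv_sum T (I : Type) (s : seq I) (P : pred I) (F : I -> H) :
  ap T (\sum_(i <- s | P i) F i) = \sum_(i <- s | P i) ap T (F i).
Proof. by apply: (big_morph (ap T)); [exact: apvD|exact: apv0]. Qed.
Lemma ap_ext S T : (forall v, ap S v = ap T v) -> S = T.
Proof. by move=> ST; apply: val_inj; apply/funext. Qed.

Lemma norm_opnorm T : `|T| = opnorm (T : compact_op H).
Proof. by []. Qed.

Lemma norm_rnorm1 v : (`|v| <= 1) = (rnorm v <= 1).
Proof. by rewrite -lecR rnormE. Qed.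

Lemma ap_le1 T v : rnorm v <= 1 -> rnorm (ap T v) <= `|T|.
Proof. by rewrite -norm_rnorm1 norm_opnorm; exact: opnorm_ub. Qed.

Lemma ap_le T v : rnorm (ap T v) <= `|T| * rnorm v.
Proof.
have [->|v0] := eqVneq v 0; first by rewrite apv0 rnorm0 mulr0.
have v1 := rnorm_normalize v0.
have v_gt0 : 0 < rnorm v by rewrite lt_neqAle eq_sym rnorm_eq0 v0 rnorm_ge0.
have := @ap_le1 T _ (eq_ind_r (fun r => r <= 1) (lexx 1) v1).
by rewrite apvZ rnormZ cabsR ger0_norm ?invr_ge0 ?rnorm_ge0// mulrC ler_pdivrMr.
Qed.

Lemma norm_le T (r : R) : (forall v, rnorm v <= 1 -> rnorm (ap T v) <= r) -> `|T| <= r.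
Proof.
move=> H1; rewrite norm_opnorm; apply: ge_sup.
  by exists (rnorm (ap T 0)), 0 => //; rewrite /unit_ball/= normr0 ler01.
by move=> _ [v Bv <-]; apply: H1; move: Bv; rewrite /unit_ball/= norm_rnorm1.
Qed.

Lemma continuous_realscale w : continuous (fun r : R => r%:C *: w).
Proof.
move=> r; apply/cvgrPdist_lt => e e0.
have [->|w0] := eqVneq w 0.
  by apply: nearW => s; rewrite !scaler0 subrr normr0.
have w_gt0 : 0 < rnorm w by rewrite lt_neqAle eq_sym rnorm_eq0 w0 rnorm_ge0.
have eE : e = (complex.Re e)%:C by rewrite RRe_real// gtr0_real.
have Re0 : 0 < complex.Re e by rewrite -ltcR -eE.
near=> s; rewrite -scalerBl -rmorphB -rnormE rnormZ cabsR eE ltcR.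
rewrite -ltr_pdivlMr//; near: s.
by apply: cvgr_dist_lt => //; rewrite divr_gt0.
Unshelve. all: by end_near. Qed.

(** On the unit ball, [dot v u] has real and imaginary parts in a compact interval; the image of the
    ball is covered by a continuous image of a square. *)
Lemma compact_operator_rank1 u w : compact_operator (fun v => dot v u *: w).
Proof.
split; first by move=> a x y; rewrite dotDl dotZl scalerDl scalerA.
pose f (p : R * R) := p.1%:C *: w + p.2%:C *: ('i *: w).
pose I : set R := `[- rnorm u, rnorm u]%classic.
apply: (@precompact_subset _ _ (f @` (I `*` I))%classic).
  move=> _ [x + <-]; rewrite /unit_ball/= norm_rnorm1 => x1.
  have := cauchy_schwarz u x; rewrite /cabs normc_def/=.
  case E : (dot x u) => [r s] /= xu.
  have {}xu : Num.sqrt (r ^+ 2 + s ^+ 2) <= rnorm u.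
    by apply: le_trans xu _; rewrite ler_piMl// rnorm_ge0.
  exists (r, s); last first.
    by rewrite /f/= scalerA -scalerDl [r +i* s]complexE mulrC.
  split; rewrite /I/= in_itv/= -ler_norml (le_trans _ xu)// -sqrtr_sqr ler_wsqrtr//.
    by rewrite lerDl sqr_ge0.
  by rewrite lerDr sqr_ge0.
apply: compact_precompact; first exact: norm_hausdorff.
apply: continuous_compact; last by apply: compact_setX; exact: segment_compact.
apply: continuous_subspaceT => p; rewrite /f.
apply: cvgD.
  apply: (@continuous_comp _ _ _ fst (fun r : R => r%:C *: w)).
    exact: cvg_fst.
  exact: continuous_realscale.
apply: (@continuous_comp _ _ _ snd (fun r : R => r%:C *: ('i *: w))).
  exact: cvg_snd.
exact: continuous_realscale.
Qed.

Definition rank1 u w : X := CompactOp (introT (asboolP _) (compact_operator_rank1 u w)).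

Lemma ap_rank1 u w v : ap (rank1 u w) v = dot v u *: w.
Proof. by []. Qed.

(** * Attainment of the operator norm *)

Lemma rnormDD (V : normedModType R[i]) (v : V) : rnorm (v + v) = 2 * rnorm v.
Proof.
rewrite -mulr2n -scaler_nat rnormZ; congr (_ * _).
by rewrite -(rmorph_nat (@real_complex R)) cabsR normr_nat.
Qed.

(** Since [T] has norm 1, [v + w] is at least as long as its image; the parallelogram law then
    bounds [|v - w|^2] by [4 - (2 - 2 d)^2]. *)
Lemma near_attaining_close T v w (d : R) : `|T| = 1 -> 0 <= d <= 1 ->
  rnorm v <= 1 -> rnorm w <= 1 -> 2 - 2 * d <= rnorm (ap T v + ap T w) ->
  rnorm (v - w) ^+ 2 <= 8 * d.
Proof.
move=> T1 /andP[d0 d1] v1 w1; rewrite -apvD => vw.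
have := le_trans vw (ap_le T (v + w)); rewrite T1 mul1r => {}vw.
have sq1 z : rnorm z <= 1 -> rnorm z ^+ 2 <= 1.
  by move=> z1; rewrite expr_le1// rnorm_ge0.
have := sq1 _ v1; have := sq1 _ w1; have := rnorm2B v w; have := rnorm2D v w.
have : (2 - 2 * d) ^+ 2 <= rnorm (v + w) ^+ 2.
  by rewrite ler_pXn2r// nnegrE ?rnorm_ge0//; lra.
nra.
Qed.

Local Open Scope classical_set_scope.

(** The images of almost maximising vectors form a filter base in a precompact set, and [y] is a
    cluster point of it. *)
Lemma unit_image_cluster T : `|T| = 1 ->
  exists2 y, 1 <= rnorm y &
    forall d : R, 0 < d -> exists2 v, rnorm v <= 1 & rnorm (ap T v - y) < d.
Proof.
move=> T1.
pose B (d : R) := [set ap T v | v in [set v | rnorm v <= 1 /\ 1 - d < rnorm (ap T v)]].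
pose F := filter_from [set d : R | 0 < d] B.
have Bne d : 0 < d -> B d !=set0.
  move=> d0; have [||_ [v Bv <-] dv] := @sup_gt R
     [set rnorm (ap T v) | v in @unit_ball _ H] (1 - d).
  - by exists (rnorm (ap T 0)), 0 => //; rewrite /unit_ball/= normr0 ler01.
  - by move: T1; rewrite norm_opnorm /opnorm => ->; rewrite ltrBlDr ltrDl.
  - by exists (ap T v), v => //; split=> //; rewrite -norm_rnorm1.
have Ff : Filter F.
  apply: filter_from_filter; first by exists 1; rewrite /=.
  move=> d e d0 e0; exists (Num.min d e); first by rewrite /= lt_min d0.
  move=> _ [v [v1 vd] <-]; split; exists v => //; split=> //;
    apply: le_lt_trans vd; rewrite lerD2l lerN2 ge_min lexx ?orbT//.
have Fp : ProperFilter F by apply: filter_from_proper.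
have [_] := compact_opP (T : compact_op H); rewrite precompactE => /(_ F Fp)[].
  exists 1 => //= _ [v [v1 _] <-]; apply: subset_closure; exists v => //.
  by rewrite /unit_ball/= norm_rnorm1.
move=> y [_ Fy].
have near d e : 0 < d -> 0 < e ->
    exists v, [/\ rnorm v <= 1, 1 - d < rnorm (ap T v) & rnorm (ap T v - y) < e].
  move=> d0 e0; have [] := Fy (B d) (ball y e%:C).
  - by exists d.
  - by apply: nbhsx_ballx; rewrite ltcR.
  move=> _ [[v [v1 vd] <-]]; rewrite -ball_normE/= => yv; exists v; split=> //.
  by rewrite rnormB -ltcR rnormE.
exists y; last first.
  by move=> d d0; have [v [? _ ?]] := near _ _ ltr01 d0; exists v.
apply/ler_addgt0Pr => e e0; have e2 : 0 < e / 2 by rewrite divr_gt0.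
have [v [_ ve yv]] := near _ _ e2 e2.
have := rnormD (ap T v - y) y; rewrite subrK; lra.
Qed.

(** Vectors of the unit ball whose images approach [y] are almost maximising, so uniform convexity
    of [H] makes them a Cauchy filter; its limit attains the norm. *)
Lemma norm_attained T : `|T| = 1 -> exists2 v, rnorm v = 1 & rnorm (ap T v) = 1.
Proof.
move=> T1; have [y y1 yT] := unit_image_cluster T1.
pose A (d : R) := [set v | rnorm v <= 1 /\ rnorm (ap T v - y) < d].
pose F := filter_from [set d : R | 0 < d] A.
have Ff : Filter F.
  apply: filter_from_filter; first by exists 1; rewrite /=.
  move=> d e d0 e0; exists (Num.min d e); first by rewrite /= lt_min d0.
  move=> v [v1 vd]; split; split=> //; apply: lt_le_trans vd _;
    by rewrite ge_min lexx ?orbT.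
have Fp : ProperFilter F.
  by apply: filter_from_proper => d d0; have [v ? ?] := yT _ d0; exists v.
have /cauchy_cvg/cvg_ex[v Fv] : cauchy F.
  apply: cauchy_exP => e e0.
  have eE : e = (complex.Re e)%:C by rewrite RRe_real// gtr0_real.
  move: e0; rewrite eE ltcR; set r := complex.Re e => r0.
  (* With this [d], [near_attaining_close] bounds [|v - w|^2] by [r^2 / 2]. *)
  pose d := Num.min 1 (r ^+ 2 / 16).
  have d0 : 0 < d by rewrite lt_min ltr01/= divr_gt0// exprn_gt0.
  have d1 : d <= 1 by rewrite ge_min lexx.
  have dr : d <= r ^+ 2 / 16 by rewrite ge_min lexx orbT.
  have [v v1 vy] := yT _ d0; exists v; exists d => // w [w1 wy].
  rewrite -ball_normE/= -rnormE ltcR.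
  have := @near_attaining_close T v w d T1 _ v1 w1.
  rewrite ltW// d1 => /(_ isT) H1.
  have {H1} : rnorm (v - w) ^+ 2 <= 8 * d.
    apply: H1.
    have := rnormD (ap T v + ap T w) ((y - ap T v) + (y - ap T w)).
    rewrite addrACA (addrC (ap T v)) subrK (addrC (ap T w)) subrK rnormDD.
    have := rnormD (y - ap T v) (y - ap T w); rewrite [rnorm (y - ap T v)]rnormB.
    rewrite [rnorm (y - ap T w)]rnormB; lra.
  move=> vw; rewrite -(ltr_pXn2r (n := 2))// ?nnegrE ?rnorm_ge0 ?ltW//; nra.
have near (e : R) : 0 < e -> exists w, [/\ rnorm w <= 1, rnorm (ap T w - y) < e
    & rnorm (v - w) < e].
  move=> e0; have e0' : 0 < e%:C by rewrite ltcR.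
  have [d d0 dA] := Fv _ (nbhsx_ballx v _ e0').
  have de : 0 < Num.min d e by rewrite lt_min d0.
  have [w w1 wy] := yT _ de; exists w; split=> //.
    by rewrite (lt_le_trans wy)// ge_min lexx orbT.
  have /dA : A d w by split=> //; rewrite (lt_le_trans wy)// ge_min lexx.
  by rewrite -ball_normE/= -rnormE ltcR.
have v1 : rnorm v <= 1.
  apply/ler_addgt0Pr => e e0; have [w [w1 _ vw]] := near _ e0.
  have := rnormD (v - w) w; rewrite subrK; lra.
have Tv : 1 <= rnorm (ap T v).
  apply/ler_addgt0Pr => e e0; have e2 : 0 < e / 2 by rewrite divr_gt0.
  have [w [w1 wy vw]] := near _ e2.
  have := ap_le T (v - w); rewrite T1 mul1r apvB.
  have := rnormD (ap T v) (ap T w - ap T v); rewrite addrC subrK.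
  have := rnormD (ap T w) (y - ap T w); rewrite addrC subrK.
  rewrite [rnorm (y - _)]rnormB [rnorm (ap T w - ap T v)]rnormB; lra.
have Tv' := ap_le T v; rewrite T1 mul1r in Tv'.
exists v; apply/eqP; rewrite eq_le.
  by rewrite v1 (le_trans Tv).
by rewrite Tv (le_trans Tv').
Qed.

Local Close Scope classical_set_scope.

(** * Faces and diagonal operators *)

(** Where the norm is attained, the first variation of [|T v|^2 - r^2 |v|^2] vanishes. Multiplying
    [z] by the conjugate of [k] turns this variation into a positive multiple of [|k|^2]. *)
Lemma first_order (T : X) (r : R) u z : `|T| <= r -> rnorm u = 1 ->
  rnorm (ap T u) = r -> dot z u = 0 -> dot (ap T z) (ap T u) = 0.
Proof.
move=> Tr u1 Tu zu; set k := dot (ap T z) (ap T u).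
have r0 : 0 <= r by rewrite -Tu rnorm_ge0.
(* Taking [e = 1 / K] keeps the quadratic term of the perturbation at most [e |k|^2], half of the
   linear term. *)
pose K := r ^+ 2 * rnorm z ^+ 2 + 1.
have K0 : 0 < K by rewrite ltr_wpDl// mulr_ge0// sqr_ge0.
pose e := K^-1; have e0 : 0 < e by rewrite invr_gt0.
have Ke : K * e = 1 by rewrite divff ?gt_eqF.
pose z' := (e%:C * k^*) *: z.
have h : rnorm (ap T (z' + u)) ^+ 2 <= r ^+ 2 * rnorm (z' + u) ^+ 2.
  rewrite -exprMn ler_pXn2r// ?nnegrE ?mulr_ge0 ?rnorm_ge0//.
  by rewrite (le_trans (ap_le T _))// ler_wpM2r// rnorm_ge0.
have zu' : dot z' u = 0 by rewrite dotZl zu mulr0.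
rewrite (pythagoras zu') apvD rnorm2D u1 expr1n Tu in h.
have rk : redot (ap T z') (ap T u) = e * cabs k ^+ 2.
  by rewrite /redot apvZ dotZl -/k mulrAC -mulrA cabs2 -rmorphM.
have nz : rnorm z' ^+ 2 = e ^+ 2 * cabs k ^+ 2 * rnorm z ^+ 2.
  by rewrite rnormZ cabsM cabs_conj cabsR (gtr0_norm e0) !exprMn.
rewrite rk nz in h.
apply/eqP; rewrite -cabs_eq0 -sqrf_eq0 eq_le sqr_ge0 andbT.
have T2 := sqr_ge0 (rnorm (ap T z')).
have E : r ^+ 2 * (e ^+ 2 * cabs k ^+ 2 * rnorm z ^+ 2) =
    e * cabs k ^+ 2 * (K * e) - e ^+ 2 * cabs k ^+ 2 by rewrite /K; ring.
rewrite mulrDr E Ke in h.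
have : e * cabs k ^+ 2 <= 0 by have := sqr_ge0 (e * cabs k); rewrite exprMn; lra.
by rewrite pmulr_rle0.
Qed.

Lemma rank1Dr u v w : rank1 u (v + w) = rank1 u v + rank1 u w.
Proof. by apply: ap_ext => z; rewrite apD !ap_rank1 scalerDr. Qed.
Lemma rank1Dl u v w : rank1 (u + v) w = rank1 u w + rank1 v w.
Proof. by apply: ap_ext => z; rewrite apD !ap_rank1 dotDr scalerDl. Qed.
Lemma rank1Nr u v : rank1 u (- v) = - rank1 u v.
Proof. by apply: ap_ext => z; rewrite apN !ap_rank1 scalerN. Qed.
Lemma rank1Nl u v : rank1 (- u) v = - rank1 u v.
Proof. by apply: ap_ext => z; rewrite apN !ap_rank1 dotNr scaleNr. Qed.
Lemma rank1ZR (r : R) u v : rank1 u (r%:C *: v) = r *: rank1 u v.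
Proof. by apply: ap_ext => z; rewrite apZ !ap_rank1 !scalerA mulrC. Qed.
Lemma rank1Z a u v : rank1 (a *: u) v = rank1 u (a^* *: v).
Proof. by apply: ap_ext => z; rewrite !ap_rank1 dotZr scalerA mulrC. Qed.
Lemma rank10r u : rank1 u 0 = 0.
Proof. by apply: ap_ext => z; rewrite ap_rank1 scaler0. Qed.
Lemma rank10l u : rank1 0 u = 0.
Proof. by apply: ap_ext => z; rewrite ap_rank1 dot0r scale0r. Qed.

Lemma norm_rank1 u w : `|rank1 u w| = rnorm u * rnorm w.
Proof.
have [->|u0] := eqVneq u 0; first by rewrite rank10l normr0 rnorm0 mul0r.
apply/eqP; rewrite eq_le; apply/andP; split.
  apply: norm_le => v v1; rewrite ap_rank1 rnormZ ler_wpM2r ?rnorm_ge0//.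
  by rewrite (le_trans (cauchy_schwarz _ _))// ler_piMl// rnorm_ge0.
have := ap_le (rank1 u w) u; rewrite ap_rank1 rnormZ dotvv cabsR.
rewrite ger0_norm ?sqr_ge0// expr2 -mulrA mulrC ler_pM2r//.
by rewrite lt_neqAle eq_sym rnorm_eq0 u0 rnorm_ge0.
Qed.

(* [T] is block diagonal with respect to [u], [w], with corner entry [a]. *)
Definition reduces T u w a : Prop :=
  ap T u = a *: w /\ forall z, dot z u = 0 -> dot (ap T z) w = 0.

Definition face u w : set X := fun T => `|T| = 1 /\ ap T u = w.

Section unit_pair.
Variables (u w : H).
Hypotheses (u1 : rnorm u = 1) (w1 : rnorm w = 1).

Lemma face_rank1 : face u w (rank1 u w).
Proof.
by split; rewrite ?norm_rank1 ?u1 ?w1 ?mulr1// ap_rank1 rnorm1_dot// scale1r.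
Qed.

Lemma face_reduces T : face u w T -> reduces T u w 1.
Proof.
move=> [T1 Tu]; split; first by rewrite scale1r.
by move=> z zu; rewrite -Tu (@first_order T 1 u z) ?T1// Tu.
Qed.

(** Replacing the corner entry keeps the block structure, so by Pythagoras it is enough that both
    blocks are contractions. *)
Lemma reduces_shift_le T a b : `|T| <= 1 -> reduces T u w a -> cabs b <= 1 ->
  `|T + rank1 u ((b - a) *: w)| <= 1.
Proof.
move=> T1 [Tu Tz] b1; apply: norm_le => v v1.
rewrite -(ler_pXn2r (n := 2)) ?nnegrE ?rnorm_ge0// expr1n.
have E : v = dot v u *: u + (v - dot v u *: u) by rewrite addrC subrK.
have zu := dot_proj v u1; move: zu E; set z := v - _ => zu E.
have -> : ap (T + rank1 u ((b - a) *: w)) v = (dot v u * b) *: w + ap T z.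
  rewrite apD ap_rank1 {1}E apvD apvZ Tu !scalerA addrAC -scalerDl.
  by congr (_ *: _ + _); ring.
rewrite pythagoras; last by rewrite dotZl (dot_eq0C (Tz _ zu)) mulr0.
rewrite rnormZ w1 mulr1 cabsM exprMn.
have : rnorm v ^+ 2 <= 1 by rewrite expr_le1// rnorm_ge0.
rewrite (rnorm2_proj v u1) -/z.
have : rnorm (ap T z) ^+ 2 <= rnorm z ^+ 2.
  rewrite ler_pXn2r ?nnegrE ?rnorm_ge0// (le_trans (ap_le T z))//.
  by rewrite ler_piMl// rnorm_ge0.
have : cabs b ^+ 2 <= 1 by rewrite expr_le1// cabs_ge0.
have := sqr_ge0 (cabs (dot v u)); nra.
Qed.

(** This point of the face over [b] lies at distance [|b - a|] from [T]; it serves to measure corner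
    entries by distances. *)
Lemma reduces_shift_face T a b : `|T| <= 1 -> reduces T u w a -> cabs b = 1 ->
  face u (b *: w) (T + rank1 u ((b - a) *: w)).
Proof.
move=> T1 Ta b1.
have Eu : ap (T + rank1 u ((b - a) *: w)) u = b *: w.
  by rewrite apD ap_rank1 Ta.1 rnorm1_dot// scale1r -scalerDl addrC subrK.
split=> //; apply/eqP; rewrite eq_le reduces_shift_le ?b1//=.
have := ap_le (T + rank1 u ((b - a) *: w)) u.
by rewrite Eu rnormZ b1 w1 u1 !mulr1.
Qed.

Lemma face_norm1 T : face u w T -> `|T| = 1.
Proof. by case. Qed.

Lemma face_normD S T : face u w S -> face u w T -> `|S + T| = 2.
Proof.
move=> [S1 Su] [T1 Tu]; apply/eqP; rewrite eq_le; apply/andP; split.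
  by rewrite (le_trans (ler_normD _ _))// S1 T1.
have := ap_le (S + T) u.
by rewrite u1 mulr1 apD Su Tu rnormDD w1 mulr1.
Qed.

(** The sum attains its norm 2 at a unit vector [v]. Equality in the triangle inequality and in
    Cauchy-Schwarz gives [v = k u] and [T v = k w] with [|k| = 1]. *)
Lemma rank1_star_face T : `|T| = 1 -> `|T + rank1 u w| = 2 -> face u w T.
Proof.
move=> T1 Tuw; split=> //.
have h1 : `|2^-1 *: (T + rank1 u w)| = 1.
  by rewrite normrZ Tuw ger0_norm ?invr_ge0// mulVf ?pnatr_eq0.
have [v v1] := norm_attained h1.
rewrite apZ rnormZ cabsR ger0_norm ?invr_ge0// apD ap_rank1 => h2.
have {}h2 : rnorm (ap T v + dot v u *: w) = 2 by lra.
have c1 : cabs (dot v u) <= 1 by rewrite -v1 cauchy_schwarz1.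
have Tv : rnorm (ap T v) <= 1 by have := ap_le T v; rewrite T1 v1 mulr1.
have := rnormD (ap T v) (dot v u *: w); rewrite h2 rnormZ w1 mulr1 => h3.
have {}c1 : cabs (dot v u) = 1 by lra.
have {}Tv : rnorm (ap T v) = 1 by lra.
have E1 : ap T v = dot v u *: w.
  apply/eqP; rewrite -subr_eq0 -rnorm_eq0 -sqrf_eq0 rnorm2B.
  have := rnorm2D (ap T v) (dot v u *: w).
  rewrite h2 Tv rnormZ w1 c1 => ?; apply/eqP; lra.
have E2 : v = dot v u *: u.
  apply/eqP; rewrite -subr_eq0 -rnorm_eq0 -sqrf_eq0.
  by have := rnorm2_proj v u1; rewrite v1 c1 => ?; apply/eqP; lra.
have k0 : dot v u != 0 by rewrite -cabs_eq0 c1 oner_eq0.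
by apply: (scalerI k0); rewrite -E1 -apvZ -E2.
Qed.

End unit_pair.

Lemma face_cover T : `|T| = 1 ->
  exists u w, [/\ rnorm u = 1, rnorm w = 1 & face u w T].
Proof.
by move=> T1; have [u u1 Tu] := norm_attained T1; exists u, (ap T u).
Qed.

(** The two distances pin down [T u] by [chord_point]. Then [T - S1] attains its norm at [u], and
    [first_order] carries the block structure from [S1] to [T]. *)
Lemma reduces_of_dist T S1 S2 u w b1 b2 (c : R) : rnorm u = 1 -> rnorm w = 1 ->
  cabs b1 = 1 -> cabs b2 = 1 -> 0 <= c <= 1 ->
  face u (b1 *: w) S1 -> face u (b2 *: w) S2 ->
  `|T - S1| <= c * cabs (b1 - b2) -> `|T - S2| <= (1 - c) * cabs (b1 - b2) ->
  reduces T u w ((1 - c)%:C * b1 + c%:C * b2).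
Proof.
move=> u1 w1 b11 b21 c01 F1 F2 d1 d2.
have d12 : rnorm (b1 *: w - b2 *: w) = cabs (b1 - b2).
  by rewrite -scalerBl rnormZ w1 mulr1.
have le S : rnorm (ap T u - ap S u) <= `|T - S|.
  by have := ap_le (T - S) u; rewrite apB u1 mulr1.
have Tu : ap T u = ((1 - c)%:C * b1 + c%:C * b2) *: w.
  rewrite scalerDl -!scalerA; apply: chord_point => //; rewrite d12.
    by have := le S1; rewrite F1.2 => /le_trans; apply.
  by have := le S2; rewrite F2.2 => /le_trans; apply.
split=> // z zu.
have b1w : rnorm (b1 *: w) = 1 by rewrite rnormZ b11 w1 mulr1.
have S1z : dot (ap S1 z) w = 0.
  have [_ /(_ z zu)] := face_reduces u1 b1w F1.
  rewrite dotZr => /eqP; rewrite mulf_eq0 => /orP[/eqP b10|/eqP//].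
  have : cabs b1^* = 0 by rewrite [_^*]b10 cabs0.
  by rewrite cabs_conj b11 => /eqP; rewrite oner_eq0.
(* In the degenerate case [T] equals [S1]. *)
have [cd0|cd0] := eqVneq (c * cabs (b1 - b2)) 0.
  by move: d1; rewrite cd0 normr_le0 subr_eq0 => /eqP ->.
have TSu : ap (T - S1) u = (c%:C * (b2 - b1)) *: w.
  by rewrite apB Tu F1.2 -scalerBl; congr (_ *: _); rewrite rmorphB rmorph1; ring.
have nTS : rnorm (ap (T - S1) u) = c * cabs (b1 - b2).
  have /andP[c0 _] := c01.
  by rewrite TSu rnormZ w1 mulr1 cabsM cabsR ger0_norm// cabsB.
have := first_order d1 u1 nTS zu.
rewrite TSu dotZr apB dotDl dotNl S1z subr0 => /eqP.
rewrite mulf_eq0 => /orP[|/eqP//].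
rewrite -cabs_eq0 cabs_conj cabsM cabsR cabsB ger0_norm ?(negbTE cd0)//.
by case/andP: c01.
Qed.

Lemma eq1_le1 (r : R) : r = 1 -> r <= 1.
Proof. by move=> ->. Qed.

(** Frames are sequences on [nat] of which only the first [n] terms count, so frames of different
    lengths share one type. *)
Definition orthonormal_upto n (u : nat -> H) : Prop :=
  forall i j, (i < n)%N -> (j < n)%N -> dot (u i) (u j) = (i == j)%:R.

Definition diag n (u w : nat -> H) (c : nat -> R[i]) : X :=
  \sum_(i < n) rank1 (u i) (c i *: w i).

Lemma orthonormal_rnorm n (u : nat -> H) i :
  orthonormal_upto n u -> (i < n)%N -> rnorm (u i) = 1.
Proof.
move=> un lt_in; apply/eqP; rewrite -(eqrXn2 (n := 2)) ?rnorm_ge0// expr1n.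
by rewrite -redotvv /redot un// eqxx.
Qed.

Lemma orthonormalW n (u : nat -> H) : orthonormal_upto n.+1 u -> orthonormal_upto n u.
Proof. by move=> un i j lt_in lt_jn; apply: un; apply: ltnW. Qed.

Lemma diag0 (u w : nat -> H) (c : nat -> R[i]) : diag 0 u w c = 0.
Proof. by rewrite /diag big_ord0. Qed.

Lemma diagS n (u w : nat -> H) (c : nat -> R[i]) :
  diag n.+1 u w c = diag n u w c + rank1 (u n) (c n *: w n).
Proof. by rewrite /diag big_ord_recr. Qed.

Lemma ap_diag n (u w : nat -> H) (c : nat -> R[i]) v :
  ap (diag n u w c) v = \sum_(i < n) (dot v (u i) * c i) *: w i.
Proof. by rewrite ap_sum; apply: eq_bigr => i _; rewrite ap_rank1 scalerA. Qed.

Lemma dot_suml (I : Type) (s : seq I) (P : pred I) (F : I -> H) v :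
  dot (\sum_(i <- s | P i) F i) v = \sum_(i <- s | P i) dot (F i) v.
Proof. by apply: (big_morph (dot^~ v)); [move=> ? ?; exact: dotDl|exact: dot0l]. Qed.

Lemma dot_ap_diag n (u w : nat -> H) (c : nat -> R[i]) v j :
  orthonormal_upto n w -> (j < n)%N ->
  dot (ap (diag n u w c) v) (w j) = dot v (u j) * c j.
Proof.
move=> wn lt_jn; rewrite ap_diag dot_suml (bigD1 (Ordinal lt_jn))//=.
rewrite big1 ?addr0; last first.
  move=> i; rewrite -val_eqE/= => /negbTE ij.
  by rewrite dotZl wn// ij mulr0.
by rewrite dotZl wn// eqxx mulr1.
Qed.

Lemma ap_diag_basis n (u w : nat -> H) (c : nat -> R[i]) j :
  orthonormal_upto n u -> (j < n)%N ->
  ap (diag n u w c) (u j) = c j *: w j.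
Proof.
move=> un lt_jn; rewrite ap_diag (bigD1 (Ordinal lt_jn))//= big1 ?addr0.
  by rewrite un// eqxx mul1r.
move=> i; rewrite -val_eqE/= eq_sym => /negbTE ij.
by rewrite un// ij mul0r scale0r.
Qed.

Lemma reduces_diag n (u w : nat -> H) (c : nat -> R[i]) j :
  orthonormal_upto n u -> orthonormal_upto n w ->
  (j < n)%N -> reduces (diag n u w c) (u j) (w j) (c j).
Proof.
move=> un wn lt_jn; split; first exact: ap_diag_basis.
by move=> z zu; rewrite dot_ap_diag// zu mul0r.
Qed.

Lemma reduces_diag_orthogonal n (u w : nat -> H) (c : nat -> R[i]) z v :
  (forall i, (i < n)%N -> dot z (u i) = 0) -> (forall i, (i < n)%N -> dot v (w i) = 0) ->
  reduces (diag n u w c) z v 0.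
Proof.
move=> zu vw; split.
  by rewrite ap_diag scale0r big1// => i _; rewrite zu// mul0r scale0r.
move=> y _; rewrite ap_diag dot_suml big1// => i _.
by rewrite dotZl (dot_eq0C (vw _ _))// mulr0.
Qed.

(** By induction: the first [n] entries give an operator with corner entry 0 at the next pair, and
    the new entry replaces this 0. *)
Lemma norm_diag_le n (u w : nat -> H) (c : nat -> R[i]) :
  orthonormal_upto n u -> orthonormal_upto n w ->
  (forall i, (i < n)%N -> cabs (c i) <= 1) -> `|diag n u w c| <= 1.
Proof.
elim: n => [|n IHn] un wn cn; first by rewrite /diag big_ord0 normr0 ler01.
rewrite diagS -[c n]subr0; apply: reduces_shift_le.
- exact: orthonormal_rnorm un _.
- exact: orthonormal_rnorm wn _.
- by apply: IHn; [exact: orthonormalW|exact: orthonormalW|move=> i /ltnW/cn].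
- apply: reduces_diag_orthogonal => i lt_in.
    by rewrite un ?gtn_eqF// (ltn_trans lt_in).
  by rewrite wn ?gtn_eqF// (ltn_trans lt_in).
- exact: cn.
Qed.

Lemma face_diag n (u w : nat -> H) (c : nat -> R[i]) :
  (0 < n)%N -> orthonormal_upto n u -> orthonormal_upto n w ->
  (forall i, (i < n)%N -> cabs (c i) <= 1) -> c 0%N = 1 ->
  face (u 0%N) (w 0%N) (diag n u w c).
Proof.
move=> n0 un wn cn c0; have Eu := ap_diag_basis w c un n0.
rewrite c0 scale1r in Eu; split=> //.
apply/eqP; rewrite eq_le norm_diag_le//=.
have := ap_le (diag n u w c) (u 0%N).
by rewrite Eu !(orthonormal_rnorm un, orthonormal_rnorm wn)// mulr1.
Qed.

(* A vector orthogonal to the frame on which [T] does not vanish would give a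
   unit pair that [T] does not reduce at [0]. *)
Lemma diag_unique n (u w : nat -> H) (c : nat -> R[i]) T :
  orthonormal_upto n u -> orthonormal_upto n w ->
  (forall i, (i < n)%N -> reduces T (u i) (w i) (c i)) ->
  (forall z v, rnorm z = 1 -> rnorm v = 1 ->
     (forall i, (i < n)%N -> dot z (u i) = 0) ->
     (forall i, (i < n)%N -> dot v (w i) = 0) -> reduces T z v 0) ->
  T = diag n u w c.
Proof.
move=> un wn Tn T0; apply: ap_ext => v.
pose p := \sum_(i < n) dot v (u i) *: u i; pose z := v - p.
have zu i : (i < n)%N -> dot z (u i) = 0.
  move=> lt_in; rewrite /z dotDl dotNl dot_suml (bigD1 (Ordinal lt_in))//= big1.
    by rewrite dotZl un// eqxx mulr1 addr0 subrr.
  by move=> j; rewrite -val_eqE/= => /negbTE ij; rewrite dotZl un// ij mulr0.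
have Tz : ap T z = 0.
  apply/eqP; apply: contraT => Tz0.
  have z0 : z != 0 by apply: contraNneq Tz0 => ->; rewrite apv0.
  pose z' := (rnorm z)^-1%:C *: z; pose y := (rnorm (ap T z))^-1%:C *: ap T z.
  have [] := T0 z' y; rewrite ?rnorm_normalize//.
  - by move=> i lt_in; rewrite dotZl zu// mulr0.
  - by move=> i lt_in; rewrite dotZl (Tn _ lt_in).2 ?mulr0// zu.
  move=> + _; rewrite scale0r apvZ => /eqP; rewrite scaler_eq0 (negbTE Tz0) orbF.
  by rewrite (inj_eq (@complexI _)) invr_eq0 rnorm_eq0 (negbTE z0).
have vE : v = p + z by rewrite /z addrCA subrr addr0.
rewrite vE.
rewrite apvD Tz apvD addr0.
have -> : ap (diag n u w c) z = 0.
  by rewrite ap_diag big1// => i _; rewrite zu// mul0r scale0r.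
rewrite addr0 !apv_sum; apply: eq_bigr => i _.
by rewrite !apvZ (Tn i _).1// ap_diag_basis.
Qed.

(** * Approximate singular value decomposition *)

Lemma finite_net T (e : R) : 0 < e -> exists n, forall m (u : nat -> H),
  (forall i, (i < m)%N -> rnorm (u i) <= 1) ->
  (forall i j, (i < j)%N -> (j < m)%N -> e < rnorm (ap T (u i) - ap T (u j))) ->
  (m <= n)%N.
Proof.
move=> e0; have e2 : 0 < (e / 2)%:C :> R[i] by rewrite ltcR divr_gt0.
have [_] := compact_opP (T : compact_op H); rewrite precompactE compact_cover.
move=> /(_ H setT (fun y => ball y (e / 2)%:C)) [].
- by move=> y _; exact: ball_open.
- by move=> y _; exists y => //; exact: ballxx.
(* The bound is the number of balls of radius [e / 2] in a finite cover: no ball contains two of the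
   images. *)
move=> D _ cov; exists #|{: D}| => m u u1 ue.
have near (i : 'I_m) : {y : D | rnorm (val y - ap T (u i)) < e / 2}.
  apply: cid; have [|y Dy] := cov (ap T (u i)).
    by apply: subset_closure; exists (u i) => //; rewrite /unit_ball/= norm_rnorm1 u1.
  rewrite -ball_normE/= -rnormE ltcR => yu.
  by exists [` Dy]%fset.
have inj : injective (fun i => sval (near i)).
  have lt_case (i j : 'I_m) : (i < j)%N -> sval (near i) = sval (near j) -> False.
    move=> ij E; have := ue _ _ ij (ltn_ord j).
    have := svalP (near i); have := svalP (near j); rewrite E.
    move: (val _) => y yj yi.
    have := rnormD (ap T (u i) - y) (y - ap T (u j)).
    rewrite addrA subrK [rnorm (_ - y)]rnormB; lra.
  move=> i j E; apply/val_inj/eqP; rewrite eqn_leq leqNgt [(j <= i)%N]leqNgt.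
  by apply/andP; split; apply/negP => /lt_case; apply.
by have := leq_card _ inj; rewrite card_ord.
Qed.

Definition singular_frame T (e : R) n (u w : nat -> H) (s : nat -> R) : Prop :=
  [/\ orthonormal_upto n u, orthonormal_upto n w,
      forall i, (i < n)%N -> reduces T (u i) (w i) (s i)%:C,
      forall i, e <= s i <= 1 & s 0%N = 1].

Lemma singular_frame1 T (e : R) : `|T| = 1 -> e <= 1 ->
  exists (u w : nat -> H) (s : nat -> R), singular_frame T e 1 u w s.
Proof.
move=> T1 e1; have [u [w [u1 w1 Tuw]]] := face_cover T1.
exists (fun=> u), (fun=> w), (fun=> 1); split=> //.
- by move=> [|//] [|//] _ _; rewrite rnorm1_dot.
- by move=> [|//] [|//] _ _; rewrite rnorm1_dot.
- by move=> i _; exact: face_reduces.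
- by move=> i; rewrite e1 lexx.
Qed.

Lemma orthonormalS n (u : nat -> H) z : orthonormal_upto n u -> rnorm z = 1 ->
  (forall i, (i < n)%N -> dot z (u i) = 0) ->
  orthonormal_upto n.+1 (fun i => if (i < n)%N then u i else z).
Proof.
move=> un z1 zu i j; rewrite !ltnS => i_n j_n.
case: ltnP => lin; case: ltnP => ljn.
- exact: un.
- by rewrite (dot_eq0C (zu _ lin)) ltn_eqF// (leq_trans lin).
- by rewrite zu// gtn_eqF// (leq_trans ljn).
- have -> : i = j by apply/eqP; rewrite eqn_leq (leq_trans i_n) ?(leq_trans j_n).
  by rewrite eqxx rnorm1_dot.
Qed.

(** Greedy step: the remainder attains its norm [r] at some [z], which is orthogonal to the earlier
    vectors and yields the next singular value. *)
Lemma singular_frameS T (e : R) n (u w : nat -> H) (s : nat -> R) :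
  `|T| = 1 -> 0 < e -> (0 < n)%N ->
  singular_frame T e n u w s ->
  e < `|T - diag n u w (fun i => (s i)%:C)| ->
  exists (u' w' : nat -> H) (s' : nat -> R), singular_frame T e n.+1 u' w' s'.
Proof.
move=> T1 e0 n0 [un wn Tn se s0]; set D := diag n u w _.
set S := T - D; set r := `|S| => er.
have r0 : 0 < r := lt_trans e0 er.
have h1 : `|r^-1 *: S| = 1 by rewrite normrZ ger0_norm ?invr_ge0 ?ltW// mulVf// gt_eqF.
have [z z1] := norm_attained h1.
rewrite apZ rnormZ cabsR ger0_norm ?invr_ge0 ?ltW// => Sz.
have {}Sz : rnorm (ap S z) = r.
  by rewrite -[LHS]mul1r -(divff (lt0r_neq0 r0)) -mulrA Sz mulr1.
have Su i : (i < n)%N -> ap S (u i) = 0.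
  by move=> lin; rewrite apB (Tn _ lin).1 ap_diag_basis// subrr.
have fo := first_order (lexx _ : `|S| <= r) z1 Sz.
have Szz : dot (ap S z) (ap S z) != 0.
  by rewrite dotvv Sz (inj_eq (@complexI _)) sqrf_eq0 gt_eqF.
(* Since [S] kills [u i], [first_order] at the component of [u i] orthogonal to [z] leaves only a
   nonzero multiple of [dot (u i) z]. *)
have uz i : (i < n)%N -> dot (u i) z = 0.
  move=> lin; have := fo _ (dot_proj (u i) z1).
  rewrite apvB Su// apvZ sub0r dotNl dotZl => /eqP.
  by rewrite oppr_eq0 mulf_eq0 (negbTE Szz) orbF => /eqP.
have zu i (lin : (i < n)%N) := dot_eq0C (uz i lin).
have Dz : ap D z = 0 by rewrite ap_diag big1// => i _; rewrite zu// mul0r scale0r.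
have Tz : ap T z = ap S z by rewrite apB Dz subr0.
pose y := r^-1%:C *: ap S z.
have y1 : rnorm y = 1.
  by rewrite rnormZ cabsR ger0_norm ?invr_ge0 ?ltW// Sz mulVf// gt_eqF.
have Sy : ap S z = r%:C *: y by rewrite scalerA -rmorphM divff ?gt_eqF// scale1r.
have yw i : (i < n)%N -> dot y (w i) = 0.
  by move=> lin; rewrite dotZl -Tz (Tn _ lin).2 ?mulr0// zu.
have rT : reduces T z y r%:C.
  split=> [|q qz]; first by rewrite Tz.
  have -> : ap T q = ap S q + ap D q by rewrite -apD subrK.
  rewrite dotDl (reduces_diag_orthogonal (fun i => (s i)%:C) zu yw).2// addr0.
  by rewrite dotZr (fo _ qz) mulr0.
have r1 : r <= 1.
  by have := ap_le T z; rewrite T1 mul1r z1 Tz Sz.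
exists (fun i => if (i < n)%N then u i else z), (fun i => if (i < n)%N then w i else y),
  (fun i => if (i < n)%N then s i else r).
split.
- exact: orthonormalS.
- exact: orthonormalS.
- by move=> i _; case: ltnP => // lin; exact: Tn.
- by move=> i; case: ltnP => // _; rewrite r1 ltW.
- by rewrite n0.
Qed.

(** If the greedy step never stopped, the vectors [T u_i = s_i w_i] would form arbitrarily long
    lists with mutual distances above [e], against [finite_net]. *)
Lemma singular_value_approx T (e : R) : `|T| = 1 -> 0 < e -> e <= 1 ->
  exists n (u w : nat -> H) (s : nat -> R), [/\ (0 < n)%N, singular_frame T e n u w s &
    `|T - diag n u w (fun i => (s i)%:C)| <= e].
Proof.
move=> T1 e0 e1; apply: contrapT => noapprox.
have [N NP] := finite_net T e0.
have frames n : exists (u w : nat -> H) (s : nat -> R), singular_frame T e n.+1 u w s.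
  elim: n => [|n [u [w [s uws]]]]; first exact: singular_frame1.
  apply: (singular_frameS T1 e0 _ uws) => //; rewrite ltNge; apply/negP => h.
  by apply: noapprox; exists n.+1, u, w, s.
have [u [w [s [un wn Tn se _]]]] := frames N.
suff : (N.+1 <= N)%N by rewrite ltnn.
apply: (NP _ u) => [i lin|i j ij ljn]; first by rewrite (orthonormal_rnorm un).
have lin := ltn_trans ij ljn.
rewrite -(ltr_pXn2r (n := 2)) ?nnegrE ?rnorm_ge0 ?ltW//.
rewrite (Tn _ lin).1 (Tn _ ljn).1 rnorm2B /redot dotZl dotZr wn// ltn_eqF//.
rewrite !mulr0 subr0 !rnormZ !(orthonormal_rnorm wn)// !mulr1.
rewrite !cabsR !real_normK ?num_real//.
have /andP[ei _] := se i; have /andP[ej _] := se j; nra.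
Qed.

(** * Affinity on diagonal operators *)

Section isometry.
Context (Y : normedModType R) (f : X -> Y).
Hypothesis fiso : sphere_isometry f.

Let f_dist S T : `|S| = 1 -> `|T| = 1 -> `|f S - f T| = `|S - T|.
Proof. by have [_ _] := fiso; apply. Qed.

Lemma face_image_convex u w S T (t : R) : rnorm u = 1 -> rnorm w = 1 ->
  face u w S -> face u w T -> 0 <= t <= 1 ->
  exists2 M, face u w M & f M = (1 - t) *: f S + t *: f T.
Proof.
move=> u1 w1 FS FT t01; apply: (@star_convex _ _ _ (face u w) (rank1 u w)) => //.
- exact: face_norm1.
- exact: face_rank1.
- exact: face_normD.
- exact: rank1_star_face.
Qed.

Lemma face_image_opp u w T : rnorm u = 1 -> rnorm w = 1 ->
  face u w T -> exists2 M, face u w M & f M = conj_opp f T.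
Proof.
move=> u1 w1 FT; apply: (@star_opp _ _ _ (face u w) (rank1 u w)) => //.
- exact: face_norm1.
- exact: face_rank1.
- exact: face_normD.
- exact: rank1_star_face.
Qed.

(** Entries are placed on a chord between unimodular [b1] and [b2], because the distances to both
    ends are then affine in the parameter. *)
Definition chord (b1 b2 : R[i]) (r : R) : R[i] := (1 - r)%:C * b1 + r%:C * b2.

Lemma chord_dist1 b1 b2 (r : R) : 0 <= r ->
  cabs (b1 - chord b1 b2 r) = r * cabs (b1 - b2).
Proof.
move=> r0; rewrite -{2}(ger0_norm r0) -cabsR -cabsM; congr cabs.
by rewrite /chord rmorphB rmorph1; ring.
Qed.

Lemma chord_dist2 b1 b2 (r : R) : r <= 1 ->
  cabs (b2 - chord b1 b2 r) = (1 - r) * cabs (b1 - b2).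
Proof.
move=> r1; rewrite -[1 - r]ger0_norm ?subr_ge0// -cabsR cabsB -cabsM.
by congr cabs; rewrite /chord rmorphB rmorph1; ring.
Qed.

Lemma norm_shift T u w a b : rnorm u = 1 -> rnorm w = 1 ->
  `|T - (T + rank1 u ((b - a) *: w))| = cabs (b - a).
Proof.
move=> u1 w1; rewrite opprD addrA subrr add0r normrN norm_rank1 u1 mul1r.
by rewrite rnormZ w1 mulr1.
Qed.

(** Shift the corners of [P] and [Q] to an end [b] of the chord. The same convex combination of the
    images is the image of a point of the face over [b], which bounds the distance from [M] to that
    face; [reduces_of_dist] then applies. *)
Lemma reduces_convex P Q M u w b1 b2 (r s t : R) : rnorm u = 1 -> rnorm w = 1 ->
  cabs b1 = 1 -> cabs b2 = 1 -> 0 <= r <= 1 -> 0 <= s <= 1 -> 0 <= t <= 1 ->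
  `|P| = 1 -> `|Q| = 1 -> `|M| = 1 -> f M = (1 - t) *: f P + t *: f Q ->
  reduces P u w (chord b1 b2 r) -> reduces Q u w (chord b1 b2 s) ->
  reduces M u w (chord b1 b2 ((1 - t) * r + t * s)).
Proof.
move=> u1 w1 b11 b21 /andP[r0 r1] /andP[s0 s1] t01 P1 Q1 M1 fM rP rQ.
have /andP[t0 t1] := t01.
have near b : cabs b = 1 -> exists2 S, face u (b *: w) S &
    `|M - S| <= (1 - t) * cabs (b - chord b1 b2 r) + t * cabs (b - chord b1 b2 s).
  move=> b_1; have bw : rnorm (b *: w) = 1 by rewrite rnormZ b_1 w1 mulr1.
  have FP := reduces_shift_face u1 w1 (eq1_le1 P1) rP b_1.
  have FQ := reduces_shift_face u1 w1 (eq1_le1 Q1) rQ b_1.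
  have [S FS fS] := face_image_convex u1 bw FP FQ t01.
  exists S => //; rewrite -f_dist//; last by case: FS.
  rewrite fM fS opprD addrACA -!scalerBr (le_trans (ler_normD _ _))//.
  rewrite !normrZ !ger0_norm ?subr_ge0// !f_dist//; [|by case: FQ|by case: FP].
  by rewrite !norm_shift.
have [S1 F1 d1] := near _ b11; have [S2 F2 d2] := near _ b21.
apply: (reduces_of_dist u1 w1 b11 b21 _ F1 F2).
- by apply/andP; split; nra.
- by move: d1; rewrite !chord_dist1//; lra.
- by move: d2; rewrite !chord_dist2//; lra.
Qed.

Lemma reduces_opp P M u w b1 b2 (r : R) : rnorm u = 1 -> rnorm w = 1 ->
  cabs b1 = 1 -> cabs b2 = 1 -> 0 <= r <= 1 ->
  `|P| = 1 -> `|M| = 1 -> f M = conj_opp f P ->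
  reduces P u w (chord b1 b2 r) -> reduces M u w (chord b1 b2 r).
Proof.
move=> u1 w1 b11 b21 /andP[r0 r1] P1 M1 fM rP.
have [_ _ f'_dist] := sphere_isometry_opp fiso.
have near b : cabs b = 1 -> exists2 S, face u (b *: w) S &
    `|M - S| <= cabs (b - chord b1 b2 r).
  move=> b_1; have bw : rnorm (b *: w) = 1 by rewrite rnormZ b_1 w1 mulr1.
  have FP := reduces_shift_face u1 w1 (eq1_le1 P1) rP b_1.
  have [S FS fS] := face_image_opp u1 bw FP.
  exists S => //; rewrite -f_dist//; last by case: FS.
  rewrite fM fS f'_dist//; last by case: FP.
  by rewrite norm_shift.
have [S1 F1 d1] := near _ b11; have [S2 F2 d2] := near _ b21.
apply: (reduces_of_dist u1 w1 b11 b21 _ F1 F2); first by rewrite r0.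
- by move: d1; rewrite chord_dist1.
- by move: d2; rewrite chord_dist2.
Qed.

Lemma chord_le1 b1 b2 (r : R) : cabs b1 = 1 -> cabs b2 = 1 -> 0 <= r <= 1 ->
  cabs (chord b1 b2 r) <= 1.
Proof.
move=> b11 b21 /andP[r0 r1]; rewrite (le_trans (cabsD _ _))// !cabsM b11 b21 !cabsR.
by rewrite !ger0_norm ?subr_ge0//; lra.
Qed.

(** The convex combination is [f M] for some [M] in the common face. By [reduces_convex], [M] has
    the averaged entries on the frames and 0 off them, so [diag_unique] identifies it. *)
Lemma diag_convex n (u w : nat -> H) (b1 b2 : nat -> R[i]) (r s : nat -> R) (t : R) :
  (0 < n)%N -> orthonormal_upto n u -> orthonormal_upto n w ->
  (forall i, [/\ cabs (b1 i) = 1, cabs (b2 i) = 1, 0 <= r i <= 1 & 0 <= s i <= 1]) ->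
  chord (b1 0) (b2 0) (r 0) = 1 -> chord (b1 0) (b2 0) (s 0) = 1 ->
  0 <= t <= 1 ->
  f (diag n u w (fun i => chord (b1 i) (b2 i) ((1 - t) * r i + t * s i))) =
  (1 - t) *: f (diag n u w (fun i => chord (b1 i) (b2 i) (r i))) +
  t *: f (diag n u w (fun i => chord (b1 i) (b2 i) (s i))).
Proof.
move=> n0 un wn brs r0 s0 t01; have /andP[t0 t1] := t01.
have u1 := orthonormal_rnorm un; have w1 := orthonormal_rnorm wn.
set P := diag n u w (fun i => chord _ _ (r i)).
set Q := diag n u w (fun i => chord _ _ (s i)).
have FP : face (u 0) (w 0) P.
  by apply: face_diag => // i _; have [? ? ? ?] := brs i; exact: chord_le1.
have FQ : face (u 0) (w 0) Q.
  by apply: face_diag => // i _; have [? ? ? ?] := brs i; exact: chord_le1.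
have [M FM fM] := face_image_convex (u1 _ n0) (w1 _ n0) FP FQ t01.
rewrite -fM; congr f; apply/esym/diag_unique => //.
  move=> i lt_in; have [b1i b2i ri si] := brs i.
  by apply: (reduces_convex (u1 _ lt_in) (w1 _ lt_in) b1i b2i ri si t01 _ _ _ fM);
    [case: FP|case: FQ|case: FM|exact: reduces_diag|exact: reduces_diag].
move=> z v z1 v1 zu vw.
(* The entry 0 off the frames is seen as the midpoint of the chord from 1 to -1. *)
have -> : 0 = chord 1 (-1) ((1 - t) * 2^-1 + t * 2^-1) :> R[i].
  by rewrite -mulrDl subrK mul1r /chord mulr1 mulrN1 -rmorphB; congr (_%:C); lra.
have chord0 : chord 1 (-1) 2^-1 = 0.
  by rewrite /chord mulr1 mulrN1 -rmorphB; congr (_%:C); lra.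
have h2 : (0 : R) <= 2^-1 <= (1 : R) by apply/andP; split; lra.
apply: (reduces_convex z1 v1 _ _ h2 h2 t01 _ _ _ fM); rewrite ?cabsN ?cabs1//.
- by case: FP.
- by case: FQ.
- by case: FM.
- by rewrite chord0; exact: reduces_diag_orthogonal.
- by rewrite chord0; exact: reduces_diag_orthogonal.
Qed.

(** The point [M] with [f M = conj_opp f P] has the same entries as [P], each lying on the chord
    from 1 to -1; hence [M = P]. *)
Lemma diag_opp n (u w : nat -> H) (c : nat -> R) :
  (0 < n)%N -> orthonormal_upto n u -> orthonormal_upto n w ->
  (forall i, -1 <= c i <= 1) -> c 0%N = 1 ->
  f (- diag n u w (fun i => (c i)%:C)) = - f (diag n u w (fun i => (c i)%:C)).
Proof.
move=> n0 un wn cn c0.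
have u1 := orthonormal_rnorm un; have w1 := orthonormal_rnorm wn.
have fiso' := sphere_isometry_opp fiso.
set P := diag n u w _.
have FP : face (u 0) (w 0) P.
  by apply: face_diag; rewrite ?c0// => i _; rewrite cabsR ler_norml.
have [M FM fM] := face_image_opp (u1 _ n0) (w1 _ n0) FP.
suff MP : M = P by rewrite -[in RHS]MP fM /conj_opp opprK.
have chordR (r : R) : r%:C = chord 1 (-1) ((1 - r) / 2).
  by rewrite /chord mulr1 mulrN1 -rmorphB; congr (_%:C); lra.
have h2 (r : R) : -1 <= r <= 1 -> 0 <= (1 - r) / 2 <= 1.
  by move=> /andP[? ?]; apply/andP; split; lra.
apply: diag_unique => // [i lt_in|z v z1 v1 zu vw].
  rewrite chordR; apply: (reduces_opp (u1 _ lt_in) (w1 _ lt_in) _ _ (h2 _ (cn i)) _ _ fM).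
  - by rewrite cabs1.
  - by rewrite cabsN cabs1.
  - by case: FP.
  - by case: FM.
  - by rewrite -chordR; exact: reduces_diag.
rewrite -[0]/(0%:C) chordR.
apply: (reduces_opp z1 v1 _ _ (h2 _ _) _ _ fM); rewrite ?cabsN ?cabs1//.
- by rewrite lerN10 ler01.
- by case: FP.
- by case: FM.
- by rewrite -chordR; exact: reduces_diag_orthogonal.
Qed.

(** * Pairs of orthogonal rank one operators *)

Definition pair_seq (x y : H) (i : nat) : H := if i == 0%N then x else y.

Lemma orthonormal_pair x y : rnorm x = 1 -> rnorm y = 1 -> dot x y = 0 ->
  orthonormal_upto 2 (pair_seq x y).
Proof.
move=> x1 y1 xy [|[|//]] [|[|//]] _ _; rewrite /pair_seq/= ?rnorm1_dot//.
exact: dot_eq0C.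
Qed.

Lemma diag_pair u1 u2 w1 w2 (c : nat -> R[i]) :
  diag 2 (pair_seq u1 u2) (pair_seq w1 w2) c =
  rank1 u1 (c 0%N *: w1) + rank1 u2 (c 1%N *: w2).
Proof. by rewrite !diagS diag0 add0r. Qed.

Section orthogonal_pairs.
Variables (u1 u2 w1 w2 : H).
Hypotheses (u11 : rnorm u1 = 1) (u21 : rnorm u2 = 1) (u12 : dot u1 u2 = 0)
  (w11 : rnorm w1 = 1) (w21 : rnorm w2 = 1) (w12 : dot w1 w2 = 0).

Lemma norm_pair a : cabs a <= 1 -> `|rank1 u1 w1 + rank1 u2 (a *: w2)| = 1.
Proof.
move=> a1; pose c (i : nat) : R[i] := if i == 0%N then 1 else a.
have [||] := @face_diag 2 _ _ c isT (orthonormal_pair u11 u21 u12)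
  (orthonormal_pair w11 w21 w12).
- by move=> [|i] _; rewrite /c/= ?cabs1.
- by [].
- by rewrite diag_pair/= scale1r.
Qed.

Lemma pair_convex b1 b2 (t : R) : cabs b1 = 1 -> cabs b2 = 1 -> 0 <= t <= 1 ->
  f (rank1 u1 w1 + rank1 u2 (chord b1 b2 t *: w2)) =
  (1 - t) *: f (rank1 u1 w1 + rank1 u2 (b1 *: w2)) +
  t *: f (rank1 u1 w1 + rank1 u2 (b2 *: w2)).
Proof.
move=> b11 b21 t01.
have chord1 (r : R) : chord 1 1 r = 1.
  by rewrite /chord !mulr1 -rmorphD subrK.
have := @diag_convex 2 (pair_seq u1 u2) (pair_seq w1 w2)
  (fun i => if i == 0%N then 1 else b1) (fun i => if i == 0%N then 1 else b2)
  (fun=> 0) (fun=> 1) t isT (orthonormal_pair u11 u21 u12)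
  (orthonormal_pair w11 w21 w12).
rewrite !diag_pair/= !chord1 mulr0 mulr1 add0r !scale1r /chord.
rewrite !subr0 !subrr !mul0r !mul1r addr0 add0r => H2; apply: H2 => //.
by move=> i; split; rewrite ?ler01 ?lexx//; case: (i == 0%N); rewrite ?cabs1.
Qed.

Lemma pair_opp (c : R) : -1 <= c <= 1 ->
  f (- (rank1 u1 w1 + rank1 u2 (c%:C *: w2))) =
  - f (rank1 u1 w1 + rank1 u2 (c%:C *: w2)).
Proof.
move=> c1; have := @diag_opp 2 (pair_seq u1 u2) (pair_seq w1 w2)
  (fun i => if i == 0%N then 1 else c) isT (orthonormal_pair u11 u21 u12)
  (orthonormal_pair w11 w21 w12).
rewrite diag_pair/= scale1r; apply=> // i.
by case: ifP => // _; rewrite lexx andbT -subr_ge0 opprK addr_ge0.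
Qed.

Lemma pair_mid : f (rank1 u1 w1 + rank1 u2 w2) + f (rank1 u1 w1 - rank1 u2 w2) =
  2 *: f (rank1 u1 w1).
Proof.
have h2 : (0 : R) <= 2^-1 <= (1 : R) by apply/andP; split; lra.
have := @pair_convex 1 (-1) 2^-1; rewrite cabsN cabs1 => /(_ erefl erefl h2).
rewrite /chord mulr1 mulrN1 -rmorphB.
have -> : 1 - 2^-1 - 2^-1 = 0 :> R by lra.
have -> : 1 - 2^-1 = 2^-1 :> R by lra.
rewrite scale0r rank10r addr0 scale1r scaleN1r rank1Nr => ->.
by rewrite -scalerDr scalerA divff ?pnatr_eq0// scale1r.
Qed.

End orthogonal_pairs.

(** Adding [pair_mid] for both orders of the pair, the values at the two opposite differences cancel
    by oddness. *)
Lemma f_pair1 u1 u2 w1 w2 : rnorm u1 = 1 -> rnorm u2 = 1 -> dot u1 u2 = 0 ->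
  rnorm w1 = 1 -> rnorm w2 = 1 -> dot w1 w2 = 0 ->
  f (rank1 u1 w1 + rank1 u2 w2) = f (rank1 u1 w1) + f (rank1 u2 w2).
Proof.
move=> u11 u21 u12 w11 w21 w12.
have e1 := pair_mid u11 u21 u12 w11 w21 w12.
have e2 := pair_mid u21 u11 (dot_eq0C u12) w21 w11 (dot_eq0C w12).
have h1 : (-1 : R) <= -1 <= (1 : R) by apply/andP; split; lra.
have := pair_opp u11 u21 u12 w11 w21 w12 h1.
rewrite rmorphN rmorph1 scaleN1r rank1Nr opprB => e3.
apply: (@scalerI _ _ (2 : R)); first by rewrite pnatr_eq0.
rewrite [RHS]scalerDr -e1 -e2 e3 [rank1 u2 w2 + _]addrC addrACA subrr addr0.
by rewrite scaler_nat mulr2n.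
Qed.

Lemma f_pair u1 u2 w1 w2 (c : R) : rnorm u1 = 1 -> rnorm u2 = 1 -> dot u1 u2 = 0 ->
  rnorm w1 = 1 -> rnorm w2 = 1 -> dot w1 w2 = 0 -> -1 <= c <= 1 ->
  f (rank1 u1 w1 + c *: rank1 u2 w2) = f (rank1 u1 w1) + c *: f (rank1 u2 w2).
Proof.
move=> u11 u21 u12 w11 w21 w12 /andP[c0 c1].
have e1 := pair_mid u11 u21 u12 w11 w21 w12.
have e2 := f_pair1 u11 u21 u12 w11 w21 w12.
have h2 : 0 <= (1 - c) / 2 <= 1 by apply/andP; split; lra.
have := @pair_convex _ _ _ _ u11 u21 u12 w11 w21 w12 1 (-1) ((1 - c) / 2).
rewrite cabsN cabs1 => /(_ erefl erefl h2).
rewrite /chord mulr1 mulrN1 -rmorphB.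
have -> : 1 - (1 - c) / 2 - (1 - c) / 2 = c :> R by lra.
have -> : 1 - (1 - c) / 2 = (1 + c) / 2 :> R by lra.
rewrite rank1ZR scale1r scaleN1r rank1Nr => ->.
have -> : f (rank1 u1 w1 - rank1 u2 w2) = f (rank1 u1 w1) - f (rank1 u2 w2).
  apply: (addrI (f (rank1 u1 w1 + rank1 u2 w2))); rewrite e1 e2 addrACA subrr addr0.
  by rewrite scaler_nat mulr2n.
rewrite e2 scalerDr scalerBr addrACA -scalerDl -scalerBl.
have -> : (1 + c) / 2 + (1 - c) / 2 = 1 :> R by lra.
have -> : (1 + c) / 2 - (1 - c) / 2 = c :> R by lra.
by rewrite scale1r.
Qed.

Lemma f_rank1N u w : rnorm u = 1 -> rnorm w = 1 -> f (- rank1 u w) = - f (rank1 u w).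
Proof.
move=> u1 w1; have := @diag_opp 1 (fun=> u) (fun=> w) (fun=> 1) isT.
rewrite diagS diag0/= add0r scale1r; apply=> //.
- by move=> [|//] [|//] _ _; rewrite rnorm1_dot.
- by move=> [|//] [|//] _ _; rewrite rnorm1_dot.
- by move=> _; rewrite lexx andbT; lra.
Qed.

(** * The homogeneous extension on rank one operators *)

Definition fx u w : Y := hom_ext f (rank1 u w).

Lemma rank1ZlR (r : R) u w : rank1 (r%:C *: u) w = r *: rank1 u w.
Proof.
by apply: ap_ext => z; rewrite apZ !ap_rank1 dotZr scalerA conjCR.
Qed.

Lemma fxZ (r : R) u w : 0 <= r -> fx u (r%:C *: w) = r *: fx u w.
Proof. by move=> r0; rewrite /fx rank1ZR hom_extZ. Qed.

Lemma fxZl (r : R) u w : 0 <= r -> fx (r%:C *: u) w = r *: fx u w.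
Proof. by move=> r0; rewrite /fx rank1ZlR hom_extZ. Qed.

Lemma fxZZ (r s : R) u w : 0 <= r -> 0 <= s ->
  fx (r%:C *: u) (s%:C *: w) = (r * s) *: fx u w.
Proof. by move=> r0 s0; rewrite fxZl// fxZ// (scalerA r s). Qed.

Lemma fx0r u : fx u 0 = 0.
Proof. by rewrite /fx rank10r hom_ext0. Qed.

Lemma fx0l w : fx 0 w = 0.
Proof. by rewrite /fx rank10l hom_ext0. Qed.

Lemma fx1 u w : rnorm u = 1 -> rnorm w = 1 -> fx u w = f (rank1 u w).
Proof. by move=> u1 w1; rewrite /fx hom_ext1// norm_rank1 u1 w1 mulr1. Qed.

Lemma unit_multiple u : u != 0 ->
  exists v (r : R), [/\ rnorm v = 1, 0 < r & u = r%:C *: v].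
Proof.
move=> u0; exists ((rnorm u)^-1%:C *: u), (rnorm u).
rewrite rnorm_normalize// lt_neqAle eq_sym rnorm_eq0 u0 rnorm_ge0; split=> //.
by rewrite scalerA -rmorphM divff ?rnorm_eq0// scale1r.
Qed.

Lemma dot_multiple_eq0 u v (r s : R) : 0 < r -> 0 < s ->
  dot (r%:C *: u) (s%:C *: v) = 0 -> dot u v = 0.
Proof.
move=> r0 s0 uv; have /eqP := cabs0; rewrite -[X in cabs X]uv.
rewrite dotZl dotZr !cabsM cabs_conj !cabsR !mulf_eq0 !normr_eq0.
by rewrite (gt_eqF r0) (gt_eqF s0) !orFb cabs_eq0 => /eqP.
Qed.

Lemma fxN u w : fx u (- w) = - fx u w.
Proof.
have [->|u0] := eqVneq u 0; first by rewrite !fx0l oppr0.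
have [->|w0] := eqVneq w 0; first by rewrite oppr0 fx0r oppr0.
have [v [r [v1 r0 ->]]] := unit_multiple u0.
have [z [s [z1 s0 ->]]] := unit_multiple w0.
by rewrite -scalerN !fxZl ?ltW// !fxZ ?ltW// !fx1 ?rnormN// rank1Nr f_rank1N// !scalerN.
Qed.

Lemma fxNl u w : fx (- u) w = - fx u w.
Proof. by rewrite -fxN /fx rank1Nl rank1Nr. Qed.

Lemma hom_ext_pair u1 u2 w1 w2 : dot u1 u2 = 0 -> dot w1 w2 = 0 ->
  hom_ext f (rank1 u1 w1 + rank1 u2 w2) = fx u1 w1 + fx u2 w2.
Proof.
move=> u12 w12.
have [->|u10] := eqVneq u1 0; first by rewrite rank10l fx0l !add0r.
have [->|w10] := eqVneq w1 0; first by rewrite rank10r fx0r !add0r.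
have [->|u20] := eqVneq u2 0; first by rewrite rank10l fx0l !addr0.
have [->|w20] := eqVneq w2 0; first by rewrite rank10r fx0r !addr0.
have unit_case v1 v2 z1 z2 (s t : R) : rnorm v1 = 1 -> rnorm v2 = 1 -> dot v1 v2 = 0 ->
    rnorm z1 = 1 -> rnorm z2 = 1 -> dot z1 z2 = 0 -> 0 <= s -> 0 <= t ->
    hom_ext f (s *: rank1 v1 z1 + t *: rank1 v2 z2) = s *: fx v1 z1 + t *: fx v2 z2.
  move=> v11 v21 v12 z11 z21 z12.
  (* The larger coefficient is factored out, so that the remaining one lies in the range of
     [f_pair]. *)
  wlog ts : v1 v2 z1 z2 s t v11 v21 v12 z11 z21 z12 / t <= s.
    move=> H1 s0 t0; have [ts|/ltW st] := leP t s; first exact: H1.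
    by rewrite addrC [RHS]addrC; apply: H1 => //; exact: dot_eq0C.
  move=> s0 t0; move: s0; rewrite [0 <= s]le_eqVlt => /predU1P[s0|s0].
    have -> : t = 0 by apply/eqP; rewrite eq_le t0 andbT s0.
    by rewrite -s0 !scale0r !addr0 hom_ext0.
  have c1 : -1 <= t / s <= 1.
    rewrite ler_pdivrMr// mul1r ts andbT (le_trans (lerN10 R))//.
    by rewrite divr_ge0// ltW.
  have st : s * (t / s) = t by rewrite mulrC divfK// gt_eqF.
  rewrite -[in LHS]st -scalerA -scalerDr hom_extZ ?ltW// hom_ext1; last first.
    rewrite -rank1ZR norm_pair// cabsR ger0_norm; last by rewrite divr_ge0// ltW.
    by case/andP: c1.
  by rewrite f_pair// !fx1// scalerDr scalerA st.
move: u12 w12.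
have [v1 [r1 [v11 r10 ->]]] := unit_multiple u10.
have [v2 [r2 [v21 r20 ->]]] := unit_multiple u20.
have [z1 [s1 [z11 s10 ->]]] := unit_multiple w10.
have [z2 [s2 [z21 s20 ->]]] := unit_multiple w20.
move=> /(dot_multiple_eq0 r10 r20) v12 /(dot_multiple_eq0 s10 s20) z12.
rewrite !fxZZ ?ltW// !rank1ZlR !rank1ZR !(scalerA _ _ (rank1 _ _)).
by apply: unit_case => //; rewrite ltW// mulr_gt0.
Qed.

Lemma polar a : exists2 b, cabs b = 1 & a = (cabs a)%:C * b.
Proof.
have [->|a0] := eqVneq a 0; first by exists 1; rewrite ?cabs1// cabs0 mul0r.
exists ((cabs a)^-1%:C * a).
  by rewrite cabsM cabsR ger0_norm ?invr_ge0 ?cabs_ge0// mulVf// cabs_eq0.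
by rewrite mulrA -rmorphM divff ?cabs_eq0// mul1r.
Qed.

(** * Additivity in each variable in dimension at least two *)

Hypothesis perp : forall u, rnorm u = 1 -> exists2 z, rnorm z = 1 & dot z u = 0.

(** Affinity along chords is available next to a common orthogonal entry 1; [perp] supplies such a
    pair [u0], [w0], whose contribution cancels by [hom_ext_pair]. *)
Lemma fx_scalarD u w a b : fx u ((a + b) *: w) = fx u (a *: w) + fx u (b *: w).
Proof.
wlog w1 : u w / rnorm u = 1 /\ rnorm w = 1 => [H1|].
  have [->|u0] := eqVneq u 0; first by rewrite !fx0l addr0.
  have [->|w0] := eqVneq w 0; first by rewrite !scaler0 !fx0r addr0.
  have [v [r [v1 r0 ->]]] := unit_multiple u0.
  have [z [s [z1 s0 ->]]] := unit_multiple w0.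
  have E c : fx (r%:C *: v) (c *: (s%:C *: z)) = (r * s) *: fx v (c *: z).
    by rewrite -fxZZ ?ltW// !scalerA mulrC.
  by rewrite !E H1// (scalerDr (r * s)).
have [u1 {}w1] := w1.
have [b1 b11 aE] := polar a; have [b2 b21 bE] := polar b.
move: aE bE (cabs_ge0 a) (cabs_ge0 b).
move: (cabs a) (cabs b) => s t aE bE s0 t0.
have [st0|st0] := eqVneq (s + t) 0.
  have [s00 t00] : s = 0 /\ t = 0 by split; lra.
  by rewrite aE bE s00 t00 !mul0r addr0 scale0r fx0r addr0.
have st : 0 < s + t by rewrite lt_neqAle eq_sym st0 addr_ge0.
(* With this weight, [a + b] is [s + t] times a point of the chord between the phases of [a] and
   [b]. *)
pose r := t / (s + t).
have rt : (s + t) * r = t by rewrite mulrC divfK.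
have rs : (s + t) * (1 - r) = s by rewrite mulrBr mulr1 rt addrK.
have r01 : 0 <= r <= 1.
  by rewrite divr_ge0 ?addr_ge0//= ler_pdivrMr// mul1r lerDr.
have abE : a + b = (s + t)%:C * chord b1 b2 r.
  rewrite aE bE /chord mulrDr !mulrA.
  have Cm (x y : R) : x%:C * y%:C = (x * y)%:C by rewrite rmorphM.
  by rewrite !Cm rs rt.
have [u0 u01 uu0] := perp u1; have [w0 w01 ww0] := perp w1.
have := pair_convex u01 u1 uu0 w01 w1 ww0 b11 b21 r01.
have C1 := chord_le1 b11 b21 r01.
rewrite -!(hom_ext1 f) ?norm_pair ?b11 ?b21//.
rewrite !hom_ext_pair// ?dotZr ?ww0 ?mulr0//.
rewrite !scalerDr addrACA -scalerDl subrK scale1r => /addrI E.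
rewrite abE -(scalerA _ _ w) fxZ ?ltW// E (scalerDr (s + t)).
rewrite (scalerA _ (1 - r)) (scalerA _ r) rs rt aE bE.
by rewrite -(scalerA _ b1) -(scalerA _ b2) !fxZ.
Qed.

(* The operator in the left-hand side is [(r + i s) e + (r - i s) e'] for the
   orthogonal rank one operators [e = <., x - i z> (y - i v) / 2] and
   [e' = <., x + i z> (y + i v) / 2]. *)
Lemma fx_quaternion x z y v (r s : R) : dot x z = 0 -> dot y v = 0 ->
  rnorm x = 1 -> rnorm z = 1 -> rnorm y = 1 -> rnorm v = 1 ->
  fx x (r%:C *: y + s%:C *: v) + fx z (r%:C *: v - s%:C *: y) =
  fx x (r%:C *: y) + fx z (r%:C *: v) + (fx x (s%:C *: v) - fx z (s%:C *: y)).
Proof.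
move=> xz yv x1 z1 y1 v1; have zx := dot_eq0C xz; have vy := dot_eq0C yv.
pose j : R[i] := 0 +i* 1.
have ii : j * j = -1.
  by apply/eqP; rewrite eq_complex/= !mul0r !mulr0 mulr1 !addr0 sub0r oppr0 !eqxx.
have i_conj : conjC j = - j by apply/eqP; rewrite eq_complex/= oppr0 !eqxx.
pose xp := x - j *: z; pose xm := x + j *: z.
pose yp := 2^-1 *: (y - j *: v); pose ym := 2^-1 *: (y + j *: v).
have xpm : dot xp xm = 0.
  rewrite dotDl dotNl !dotDr !dotZl !dotZr xz zx !rnorm1_dot//.
  rewrite i_conj !mulr0 addr0 add0r !mulr1 mulrN ii; ring.
have ypm : dot yp ym = 0.
  rewrite !dotZl !dotZr dotDl dotNl !dotDr !dotZl !dotZr yv vy !rnorm1_dot//.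
  by rewrite i_conj !mulr0 addr0 add0r !mulr1 mulrN ii opprK subrr !mulr0.
have hh : 2^-1 + 2^-1 = 1 :> R[i] by rewrite -mulr2n -[_ *+ 2]mulr_natr mulVf// pnatr_eq0.
have key a b : rank1 x (a *: y + b *: v) + rank1 z (a *: v - b *: y) =
    rank1 xp ((a + j * b) *: yp) + rank1 xm ((a - j * b) *: ym).
  apply: ap_ext => p; rewrite !apD !ap_rank1 /xp /xm !dotDr dotNr !dotZr i_conj.
  rewrite /yp /ym; move: (dot p x) (dot p z) (2^-1 : R[i]) hh => X Z h hh'.
  have lin c1 c2 c3 c4 : c1 *: y + c2 *: v + (c3 *: y + c4 *: v) =
      (c1 + c3) *: y + (c2 + c4) *: v by rewrite addrACA -!scalerDl.
  have -> : X *: (a *: y + b *: v) + Z *: (a *: v - b *: y) =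
      (X * a) *: y + (X * b) *: v + ((- (Z * b)) *: y + (Z * a) *: v).
    by rewrite !scalerDr scalerN !scalerA scaleNr [- _ + _]addrC.
  rewrite lin !scalerDr !scalerN !scalerA -![- (_ *: v)]scaleNr lin.
  congr (_ *: _ + _ *: _).
    transitivity ((h + h) * (X * a + j * j * (Z * b))); last by ring.
    by rewrite hh' ii mul1r mulN1r.
  transitivity ((h + h) * - (j * j) * (X * b + Z * a)); last by ring.
  by rewrite hh' ii opprK !mul1r.
(* The extension splits over the two orthogonal operators by [hom_ext_pair], and each part is
   additive in its coefficient by [fx_scalarD]. *)
pose A a b := hom_ext f (rank1 xp ((a + j * b) *: yp) + rank1 xm ((a - j * b) *: ym)).
have AD (a b : R[i]) : A a b = A a 0 + A 0 b.
  have o c d : dot (c *: yp) (d *: ym) = 0 by rewrite dotZl dotZr ypm !mulr0.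
  rewrite /A !hom_ext_pair// !mulr0 addr0 subr0 add0r sub0r.
  by rewrite !fx_scalarD addrACA.
have AE (a b : R) : A a%:C b%:C =
    fx x (a%:C *: y + b%:C *: v) + fx z (a%:C *: v - b%:C *: y).
  rewrite /A -key hom_ext_pair//.
  rewrite dotDl !dotDr !dotNr !dotZl !dotZr yv vy !rnorm1_dot// !mulr0 !mulr1.
  by rewrite oppr0 addr0 add0r !conjCR; ring.
have c0 : (0 : R)%:C = 0 by [].
have ea := AE r 0; have eb := AE 0 s.
rewrite c0 !scale0r subr0 addr0 in ea; rewrite c0 !scale0r !add0r fxN in eb.
by rewrite -AE AD ea eb.
Qed.

(** Adding [fx_quaternion] for an auxiliary [z] and for [- z] cancels all terms in [z]. *)
Lemma fx_addr x y1 y2 : dot y1 y2 = 0 -> fx x (y1 + y2) = fx x y1 + fx x y2.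
Proof.
move=> y12.
have [->|x0] := eqVneq x 0; first by rewrite !fx0l addr0.
have [->|y10] := eqVneq y1 0; first by rewrite fx0r !add0r.
have [->|y20] := eqVneq y2 0; first by rewrite fx0r !addr0.
have [v [c [v1 c0 ->]]] := unit_multiple x0.
move: y12; have [y [r [yn r0 ->]]] := unit_multiple y10.
have [w [s [wn s0 ->]]] := unit_multiple y20.
move=> /(dot_multiple_eq0 r0 s0) yw.
rewrite !fxZl ?ltW// -scalerDr; congr (_ *: _).
have [z z1 zv] := perp v1; have vz := dot_eq0C zv.
have zN : dot v (- z) = 0 by rewrite dotNr vz oppr0.
have z1N : rnorm (- z) = 1 by rewrite rnormN.
have e1 := fx_quaternion r s vz yw v1 z1 yn wn.
have e2 := fx_quaternion r s zN yw v1 z1N yn wn.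
apply: (@scalerI _ _ (2 : R)); first by rewrite pnatr_eq0.
have := congr2 +%R e1 e2; rewrite !fxNl addrACA subrr addr0 => E.
rewrite !scaler_nat !mulr2n E [RHS]addrACA [LHS]addrACA.
congr (_ + _); rewrite addrACA ?subrr ?addr0//.
Qed.

(** The operator of [fx_quaternion] is also an orthogonal sum when its terms are grouped by their
    ranges; comparing both groupings for [z] and [- z] isolates the left variable. *)
Lemma fx_addl x1 x2 y : dot x1 x2 = 0 -> fx (x1 + x2) y = fx x1 y + fx x2 y.
Proof.
move=> x12.
have [->|y0] := eqVneq y 0; first by rewrite !fx0r addr0.
have [->|x10] := eqVneq x1 0; first by rewrite fx0l !add0r.
have [->|x20] := eqVneq x2 0; first by rewrite fx0l !addr0.
have [v [c [v1 c0 ->]]] := unit_multiple y0.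
move: x12; have [x [r [xn r0 ->]]] := unit_multiple x10.
have [w [s [wn s0 ->]]] := unit_multiple x20.
move=> /(dot_multiple_eq0 r0 s0) xw.
rewrite !fxZ ?ltW// -scalerDr; congr (_ *: _).
have [z z1 zv] := perp v1; have vz := dot_eq0C zv.
(* One operator, split along [x], [w] on the left and along [v], [q] on the right. *)
have reg (t : R) (q : H) : dot v q = 0 -> rnorm q = 1 ->
    fx x (r%:C *: v + t%:C *: q) + fx w (r%:C *: q - t%:C *: v) =
    fx (r%:C *: x - t%:C *: w) v + fx (t%:C *: x + r%:C *: w) q.
  move=> vq q1; rewrite -!hom_ext_pair//.
  - congr hom_ext; apply: ap_ext => p; rewrite !apD !ap_rank1 !dotDr dotNr !dotZr !conjCR.
    rewrite !scalerDr !scalerDl !scalerN !scalerA scaleNr ![_ * dot p _]mulrC.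
    by rewrite [X in _ + X = _]addrC addrACA.
  - rewrite dotDl dotNl !dotDr !dotZl !dotZr !conjCR xw (dot_eq0C xw).
    by rewrite !rnorm1_dot// !mulr0 !mulr1 addr0 add0r; ring.
  rewrite dotDl !dotDr !dotNr !dotZl !dotZr !conjCR vq (dot_eq0C vq).
  by rewrite !rnorm1_dot// !mulr0 !mulr1 oppr0 addr0 add0r; ring.
have vzN : dot v (- z) = 0 by rewrite dotNr vz oppr0.
have z1N : rnorm (- z) = 1 by rewrite rnormN.
have main (t : R) : fx (r%:C *: x - t%:C *: w) v = fx x (r%:C *: v) - fx w (t%:C *: v).
  have e1 := fx_quaternion r t xw vz xn wn v1 z1.
  have e2 := fx_quaternion r t xw vzN xn wn v1 z1N.
  rewrite reg// in e1; rewrite reg// !scalerN !fxN in e2.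
  apply: (@scalerI _ _ (2 : R)); first by rewrite pnatr_eq0.
  have := congr2 +%R e1 e2; rewrite addrACA subrr addr0 => E.
  rewrite !scaler_nat !mulr2n E [LHS]addrACA [RHS]addrACA.
  by congr (_ + _); rewrite addrACA subrr ?addr0 ?add0r.
(* The parameter may be negative, so the difference in [main] becomes the desired sum. *)
have := main (- s); rewrite rmorphN !scaleNr opprK fxN opprK => ->.
by rewrite !fxZ ?fxZl// ltW.
Qed.

Lemma eq_diag n (u w : nat -> H) (c d : nat -> R[i]) :
  (forall i, (i < n)%N -> c i = d i) -> diag n u w c = diag n u w d.
Proof. by move=> cd; apply: eq_bigr => i _; rewrite cd. Qed.

(** * Values on real diagonal operators *)

Section real_diag.
Variables (n : nat) (u w : nat -> H).
Hypotheses (un : orthonormal_upto n.+1 u) (wn : orthonormal_upto n.+1 w).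

Let D (c : nat -> R) : X := diag n.+1 u w (fun i => (c i)%:C).

Lemma diag_affine (c d : nat -> R) : (forall i, -1 <= c i <= 1) ->
  (forall i, -1 <= d i <= 1) -> c 0%N = 1 -> d 0%N = 1 ->
  f (D (fun i => 2^-1 * c i + 2^-1 * d i)) = 2^-1 *: (f (D c) + f (D d)).
Proof.
move=> c1 d1 c0 d0.
have h2 : (0 : R) <= 2^-1 <= (1 : R) by apply/andP; split; lra.
have chordR (r : R) : chord 1 (-1) ((1 - r) / 2) = r%:C.
  by rewrite /chord mulr1 mulrN1 -rmorphB; congr (_%:C); lra.
have := @diag_convex n.+1 u w (fun=> 1) (fun=> -1) (fun i => (1 - c i) / 2)
  (fun i => (1 - d i) / 2) 2^-1 isT un wn.
rewrite !chordR c0 d0.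
have -> : (1 - 2^-1 : R) = 2^-1 by lra.
have E (r : nat -> R) : diag n.+1 u w (fun i => chord 1 (-1) ((1 - r i) / 2)) = D r.
  by apply: eq_diag => i _; exact: chordR.
rewrite !E scalerDr => <- //; last first.
  move=> i; rewrite cabsN cabs1; have /andP[? ?] := c1 i; have /andP[? ?] := d1 i.
  by split=> //; apply/andP; split; lra.
congr f; apply: eq_diag => i _; rewrite -chordR; congr chord; lra.
Qed.

Let trunc k (c : nat -> R) i := if (i < k)%N then c i else 0.

(** Entries are switched on one at a time: [diag_affine] compares midpoints of operators sharing the
    entry 1 at index 0, and [f_pair] evaluates those with two entries. *)
Lemma f_diag (c : nat -> R) : (forall i, -1 <= c i <= 1) -> c 0%N = 1 ->
  f (D c) = \sum_(i < n.+1) c i *: f (rank1 (u i) (w i)).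
Proof.
move=> c1 c0.
have i1 : -1 <= (1 : R) <= (1 : R) by apply/andP; split; lra.
have i0 : -1 <= (0 : R) <= (1 : R) by apply/andP; split; lra.
have trunc1 k i : -1 <= trunc k c i <= 1 by rewrite /trunc; case: ifP.
pose single k (i : nat) : R := if i == 0%N then 1 else if i == k then c k else 0.
have single1 k i : -1 <= single k i <= 1 by rewrite /single; case: ifP => // _; case: ifP.
have D0 : D (single 0%N) = rank1 (u 0%N) (w 0%N).
  rewrite /D /diag big_ord_recl /= scale1r big1 ?addr0// => i _.
  by rewrite /single/= scale0r rank10r.
have Dk k : (0 < k <= n)%N -> D (single k) =
    rank1 (u 0%N) (w 0%N) + c k *: rank1 (u k) (w k).
  move=> /andP[k0 kn]; have kn1 : (k < n.+1)%N by [].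
  rewrite /D /diag big_ord_recl /= scale1r; congr (_ + _).
  have kn' : (k.-1 < n)%N by rewrite prednK.
  rewrite (bigD1 (Ordinal kn'))//= big1 ?addr0.
    by rewrite /single /bump/= add1n prednK// eqxx rank1ZR.
  move=> i; rewrite -val_eqE/= => /negbTE ik.
  by rewrite /single /bump/= add1n -(prednK k0) eqSS ik scale0r rank10r.
have u1 := orthonormal_rnorm un; have w1 := orthonormal_rnorm wn.
have step k : (0 < k <= n)%N ->
    f (D (trunc k.+1 c)) = f (D (trunc k c)) + c k *: f (rank1 (u k) (w k)).
  move=> kn; have /andP[k0 kn1] := kn.
  have e1 := diag_affine (trunc1 k.+1) (single1 0%N) c0 erefl.
  have e2 : f (D (fun i => 2^-1 * trunc k c i + 2^-1 * single k i)) =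
      2^-1 *: (f (D (trunc k c)) + f (D (single k))).
    by apply: diag_affine => //; rewrite /trunc k0.
  have h0 : 2^-1 != 0 :> R by rewrite invr_eq0 pnatr_eq0.
  (* The entries of [trunc k.+1 c] and [single 0] have the same sums as those of [trunc k c] and
     [single k], so the two midpoints coincide. *)
  have : f (D (trunc k.+1 c)) + f (D (single 0%N)) = f (D (trunc k c)) + f (D (single k)).
    apply: (scalerI h0); rewrite -e1 -e2; congr f; apply: eq_diag => i _; congr (_%:C).
    rewrite /trunc /single ltnS; case: (ltngtP i k) => [ik|ik|->].
    - by case: (i == 0%N).
    - by case: (i == 0%N).
    - by rewrite (gtn_eqF k0); lra.
  rewrite D0 Dk// f_pair ?u1 ?w1//; last 2 first.
  - by rewrite un// ltn_eqF.
  - by rewrite wn// ltn_eqF.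
  by rewrite [f (rank1 (u 0%N) _) + _]addrC addrA => /addIr.
have sums k : (k <= n)%N ->
    f (D (trunc k.+1 c)) = \sum_(i < k.+1) c i *: f (rank1 (u i) (w i)).
  elim: k => [_|k IHk kn].
    rewrite big_ord1 c0 scale1r -D0; congr f; apply: eq_diag => -[|i] _.
      by rewrite /trunc/= c0.
    by rewrite /trunc /single/=.
  by rewrite big_ord_recr/= step ?kn// IHk ?(ltnW kn).
rewrite -sums//; congr f; apply: eq_diag => i lin.
by rewrite /trunc lin.
Qed.

End real_diag.

(** The line [1 + s g] lies below [N], which exceeds 1 only to second order in [s], so its slope is
    0. The test value [s = g / (k + 1)] has the sign of [g], which allows squaring. *)
Lemma zero_of_sublinear_growth (g k : R) (N : R -> R) : 0 <= k ->
  (forall s, 1 + s * g <= N s) -> (forall s, 0 <= N s) ->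
  (forall s, N s ^+ 2 <= 1 + s ^+ 2 * k) -> g = 0.
Proof.
move=> k0 Ng N0 Nk; pose s := g / (k + 1).
have K0 : 0 < k + 1 by rewrite ltr_wpDl.
have gs : g = s * (k + 1) by rewrite divfK// gt_eqF.
have := Ng s; have := Nk s; have := N0 s; move: (N s) => M M0 M2 Mg.
have h : (1 + s * g) ^+ 2 <= M ^+ 2.
  by rewrite ler_pXn2r// nnegrE// gs mulrA -expr2 addr_ge0// mulr_ge0 ?sqr_ge0// ltW.
have s2 := sqr_ge0 s.
have : s ^+ 2 <= 0.
  rewrite gs in h; have := le_trans h M2.
  have -> : (1 + s * (s * (k + 1))) ^+ 2 =
     1 + s ^+ 2 * k + s ^+ 2 * (k + 2) + (s ^+ 2 * (k + 1)) ^+ 2 by ring.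
  have := sqr_ge0 (s ^+ 2 * (k + 1)); have := mulr_ge0 s2 k0; nra.
move=> s20; have /eqP : s ^+ 2 = 0 by apply/eqP; rewrite eq_le s20 s2.
by rewrite sqrf_eq0 => /eqP s00; rewrite gs s00 mul0r.
Qed.

(** * Norming functionals at rank one operators *)

Section evaluation.
Variables (u w : H) (psi : Y -> R).
Hypotheses (u1 : rnorm u = 1) (w1 : rnorm w = 1) (lpsi : linear (psi : Y -> R^o))
  (psi_le : forall v : Y, psi v <= `|v|) (psi_uw : psi (f (rank1 u w)) = 1).

Lemma fxZR (r : R) x y : fx x (r%:C *: y) = r *: fx x y.
Proof.
have [r0|/ltW r0] := leP 0 r; first exact: fxZ.
by rewrite -[r]opprK rmorphN scaleNr fxN fxZ ?oppr_ge0// (scaleNr (- r)).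
Qed.

(** Smoothness of the norm at [rank1 u w]: [psi] bounds the norm from below along a line on which it
    grows only quadratically, so [psi] vanishes in that direction. *)
Lemma psi_fx_eq0 x y (k : R) : 0 <= k ->
  (forall s : R,
     hom_ext f (rank1 u w + rank1 x (s%:C *: y)) = fx u w + fx x (s%:C *: y)) ->
  (forall s : R, `|rank1 u w + rank1 x (s%:C *: y)| ^+ 2 <= 1 + s ^+ 2 * k) ->
  psi (fx x y) = 0.
Proof.
move=> k0 add norm.
pose N (s : R) := `|rank1 u w + rank1 x (s%:C *: y)|.
apply: (@zero_of_sublinear_growth _ _ N k0) => s; [|exact: normr_ge0|exact: norm].
rewrite /N.
rewrite -(hom_ext_norm _ fiso) add (le_trans _ (psi_le _))//.
by rewrite (linear_funD lpsi) (fx1 u1 w1) psi_uw fxZR (linear_funZ lpsi s).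
Qed.

Lemma psi_fx_right y : dot y w = 0 -> psi (fx u y) = 0.
Proof.
move=> yw; apply: (@psi_fx_eq0 _ _ (rnorm y ^+ 2)) => [|s|s]; first exact: sqr_ge0.
  by rewrite -rank1Dr -/(fx u _) fx_addr// dotZr (dot_eq0C yw) mulr0.
rewrite -rank1Dr norm_rank1 u1 mul1r pythagoras; last first.
  by rewrite dotZr (dot_eq0C yw) mulr0.
by rewrite w1 rnormZ cabsR exprMn real_normK ?num_real// expr1n.
Qed.

Lemma psi_fx_left x : dot x u = 0 -> psi (fx x w) = 0.
Proof.
move=> xu; apply: (@psi_fx_eq0 _ _ (rnorm x ^+ 2)) => [|s|s]; first exact: sqr_ge0.
  rewrite rank1ZR -rank1ZlR -rank1Dl -/(fx _ w) fx_addl; last first.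
    by rewrite dotZr (dot_eq0C xu) mulr0.
  by rewrite /fx rank1ZR rank1ZlR.
rewrite rank1ZR -rank1ZlR -rank1Dl norm_rank1 w1 mulr1 pythagoras; last first.
  by rewrite dotZr (dot_eq0C xu) mulr0.
by rewrite u1 rnormZ cabsR exprMn real_normK ?num_real// expr1n.
Qed.

Lemma psi_fx_orthogonal x y : dot x u = 0 -> dot y w = 0 -> psi (fx x y) = 0.
Proof.
move=> xu yw; apply: (@psi_fx_eq0 _ _ (rnorm x ^+ 2 * rnorm y ^+ 2)) => [|s|s].
- by rewrite mulr_ge0 ?sqr_ge0.
- by rewrite hom_ext_pair ?(dot_eq0C xu)// dotZr (dot_eq0C yw) mulr0.
(* The vectors [w] and [y] are orthogonal, so Pythagoras applies pointwise, and Cauchy-Schwarz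
   bounds each coefficient separately. *)
have k0 : 0 <= 1 + s ^+ 2 * (rnorm x ^+ 2 * rnorm y ^+ 2).
  by rewrite addr_ge0// mulr_ge0 ?sqr_ge0// mulr_ge0 ?sqr_ge0.
rewrite -(sqr_sqrtr k0) ler_pXn2r ?nnegrE ?sqrtr_ge0//; apply: norm_le => v v1.
rewrite -(ler_pXn2r (n := 2)) ?nnegrE ?rnorm_ge0 ?sqrtr_ge0// sqr_sqrtr//.
rewrite apD !ap_rank1 pythagoras; last first.
  by rewrite dotZl !dotZr (dot_eq0C yw) !mulr0.
rewrite !rnormZ w1 mulr1 cabsR !exprMn real_normK ?num_real//.
have le1 (r t : R) : 0 <= r -> r <= t -> r ^+ 2 <= t ^+ 2.
  by move=> r0 rt; rewrite ler_pXn2r// nnegrE ?(le_trans r0).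
apply: lerD.
  rewrite -(expr1n _ 2); apply: le1; first exact: cabs_ge0.
  by rewrite (le_trans (cauchy_schwarz _ _))// u1 mulr1.
rewrite mulrCA ler_wpM2l ?sqr_ge0// ler_wpM2r ?sqr_ge0//; apply: le1.
  exact: cabs_ge0.
by rewrite (le_trans (cauchy_schwarz _ _))// ler_piMl// rnorm_ge0.
Qed.

(** Since [|1 + s j|^2 = 1 + s^2], the direction [j *: w] is killed by [psi] and only the real part
    of [a] remains. *)
Lemma psi_fx_scalar a : psi (fx u (a *: w)) = complex.Re a.
Proof.
case: a => p q /=; pose j : R[i] := 0 +i* 1.
have -> : p +i* q = p%:C + q%:C * j.
  by apply/eqP; rewrite eq_complex/= !mul0r !mulr0 !mulr1 subrr !addr0 add0r !eqxx.
have psij : psi (fx u (j *: w)) = 0.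
  apply: (@psi_fx_eq0 _ _ 1) => // s.
    rewrite -[X in rank1 u X]scale1r scalerA -rank1Dr -scalerDl -/(fx u _).
    by rewrite fx_scalarD scale1r.
  rewrite scalerA -[X in rank1 u X + _]scale1r -rank1Dr -scalerDl norm_rank1.
  rewrite u1 mul1r rnormZ w1 mulr1 /cabs normc_def/= sqr_sqrtr.
    by rewrite !mul0r !mulr0 !mulr1 !subrr !addr0 add0r expr1n.
  by rewrite addr_ge0// sqr_ge0.
rewrite fx_scalarD -(scalerA q%:C) !fxZR (linear_funD lpsi).
rewrite (linear_funZ lpsi p) (linear_funZ lpsi q) psij (fx1 u1 w1) psi_uw.
by rewrite /GRing.scale/= mulr1 mulr0 addr0.
Qed.

(** Splitting [x] along [u] and [y] along [w] gives four terms, of which only the corner one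
    survives. *)
Lemma psi_fx x y : psi (fx x y) = redot (ap (rank1 x y) u) w.
Proof.
pose x' := x - dot x u *: u; pose y' := y - dot y w *: w.
have xu : dot x' u = 0 := dot_proj x u1; have yw : dot y' w = 0 := dot_proj y w1.
have xE : x = dot x u *: u + x' by rewrite addrC subrK.
have yE : y = dot y w *: w + y' by rewrite addrC subrK.
clearbody x' y'.
have fxZ' a p q : fx (a *: p) q = fx p (a^* *: q) by rewrite /fx rank1Z.
rewrite ap_rank1 /redot dotZl; move: xE yE; set a := dot x u; set b := dot y w => xE yE.
rewrite [dot u x]dotC -/a {1}xE {1}yE fx_addl; last first.
  by rewrite dotZl (dot_eq0C xu) mulr0.
have bw c : dot (c *: w) y' = 0 by rewrite dotZl (dot_eq0C yw) mulr0.
rewrite fxZ' scalerDr scalerA !fx_addr//; last first.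
  by rewrite -scalerA !dotZl dotZr (dot_eq0C yw) !mulr0.
have -> : fx x' (b *: w) = fx (conjC b *: x') w by rewrite fxZ' conjCK.
rewrite !(linear_funD lpsi) psi_fx_scalar psi_fx_right; last by rewrite dotZl yw mulr0.
rewrite psi_fx_left ?psi_fx_orthogonal ?addr0//.
by rewrite dotZl xu mulr0.
Qed.

Lemma redot_suml (I : Type) (s : seq I) (P : pred I) (F : I -> H) v :
  redot (\sum_(i <- s | P i) F i) v = \sum_(i <- s | P i) redot (F i) v.
Proof.
apply: (big_morph (redot^~ v)); first by move=> ? ?; exact: redotDl.
by rewrite /redot dot0l.
Qed.

(** The formula holds at finite diagonal operators by [f_diag] and [psi_fx]. Both sides change by at
    most the distance, and such operators approximate [T]. *)
Lemma psi_f T : `|T| = 1 -> psi (f T) = redot (ap T u) w.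
Proof.
move=> T1; apply/eqP; rewrite -subr_eq0 -normr_le0.
apply/ler_addgt0Pr => e0 e00; rewrite add0r.
(* Half of the tolerance goes to each side; [e <= 1] is the range of [singular_value_approx]. *)
pose e := Num.min 1 (e0 / 2).
have e_gt0 : 0 < e by rewrite lt_min ltr01 divr_gt0.
have e1 : e <= 1 by rewrite ge_min lexx.
have ee : e <= e0 / 2 by rewrite ge_min lexx orbT.
have [m [x [y [s [m0 [xm ym _ se s0] TD]]]]] := singular_value_approx T1 e_gt0 e1.
case: m m0 xm ym TD => // n _ xn yn TD.
set D := diag _ _ _ _ in TD.
have s1 i : -1 <= s i <= 1 by have /andP[? ?] := se i; apply/andP; split; lra.
have D1 : `|D| = 1.
  have [] // := @face_diag n.+1 x y (fun i => (s i)%:C) isT xn yn; last by rewrite s0.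
  by move=> i _; rewrite cabsR ler_norml.
have psiD : psi (f D) = redot (ap D u) w.
  rewrite /D f_diag// ap_sum redot_suml.
  rewrite (big_morph psi (linear_funD lpsi) (linear_fun0 lpsi)).
  apply: eq_bigr => i _.
  rewrite rank1ZR apZ redotZl (linear_funZ lpsi (s i)) -psi_fx fx1//.
    by rewrite (orthonormal_rnorm xn).
  by rewrite (orthonormal_rnorm yn).
have psi_norm (v : Y) : `|psi v| <= `|v|.
  rewrite ler_norml psi_le andbT lerNl -(linear_funN lpsi).
  by rewrite (le_trans (psi_le _))// normrN.
have -> : psi (f T) - redot (ap T u) w = psi (f T - f D) - redot (ap (T - D) u) w.
  rewrite (linear_funB lpsi) psiD apB redotDl redotNl; lra.
rewrite (le_trans (ler_normB _ _))//.
have h1 : `|psi (f T - f D)| <= e by rewrite (le_trans (psi_norm _))// f_dist.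
have h2 : `|redot (ap (T - D) u) w| <= e.
  have ub S : redot (ap S u) w <= `|S|.
    rewrite (le_trans (redot_le _ _))// w1 mulr1.
    by have := ap_le S u; rewrite u1 mulr1.
  rewrite ler_norml lerNl -redotNl -apN; apply/andP; split.
    by rewrite (le_trans (ub _))// normrN.
  exact: le_trans (ub _) TD.
lra.
Qed.

End evaluation.

(** If [T] attains its norm at [u] with [T u = w], a norming functional at [f (rank1 u w)]
    corresponds to [S] mapping to the real part of [dot (S u) w]. *)
Lemma compact_sphere_dual T : `|T| = 1 ->
  exists (psi : Y -> R) (phi : X -> R),
     [/\ linear (psi : Y -> R^o), linear (phi : X -> R^o),
         (forall S, `|S| = 1 -> psi (f S) = phi S) & phi T = 1].
Proof.
move=> T1; have [u [w [u1 w1 [_ Tu]]]] := face_cover T1.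
have [f1 _ _] := fiso.
have [|psi [lpsi psi_le psi1]] := @norming_functional R Y (f (rank1 u w)).
  by rewrite f1// norm_rank1 u1 w1 mulr1.
exists psi, (fun S => redot (ap S u) w); split=> //.
- by move=> r S1 S2; rewrite apD apZ redotDl redotZl.
- by move=> S S1; exact: psi_f.
- by rewrite Tu redotvv w1 expr1n.
Qed.

End isometry.

(** When [u] spans [H], the norm of an operator is that of its value at [u], so [X] is a real inner
    product space. *)
Lemma line_sphere_dual (Y : normedModType R) (f : X -> Y) u T : sphere_isometry f ->
  rnorm u = 1 -> (forall z, dot z u = 0 -> z = 0) -> `|T| = 1 ->
  exists (psi : Y -> R) (phi : X -> R),
     [/\ linear (psi : Y -> R^o), linear (phi : X -> R^o),
         (forall S, `|S| = 1 -> psi (f S) = phi S) & phi T = 1].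
Proof.
move=> fiso u1 Hu T1.
have norm_u S : `|S| = rnorm (ap S u).
  apply/eqP; rewrite eq_le; apply/andP; split; last first.
    by have := ap_le S u; rewrite u1 mulr1.
  apply: norm_le => v v1.
  have /eqP := Hu _ (dot_proj v u1); rewrite subr_eq0 => /eqP ->.
  rewrite apvZ rnormZ ler_piMl ?rnorm_ge0//.
  by rewrite (le_trans (cauchy_schwarz _ _))// u1 mulr1.
apply: (@inner_product_sphere_dual R X Y (fun S T => redot (ap S u) (ap T u))) => //.
- by move=> S1 S2; exact: redotC.
- by move=> S1 S2 S3; rewrite apD redotDl.
- by move=> r S1 S2; rewrite apZ redotZl.
- by move=> S; rewrite redotvv norm_u.
Qed.

Lemma compact_op_sphere_dual (Y : normedModType R) (f : X -> Y) :
  sphere_isometry f -> forall T, `|T| = 1 ->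
  exists (psi : Y -> R) (phi : X -> R),
     [/\ linear (psi : Y -> R^o), linear (phi : X -> R^o),
         (forall S, `|S| = 1 -> psi (f S) = phi S) & phi T = 1].
Proof.
move=> fiso T T1.
have [perp|] := pselect (forall u, rnorm u = 1 -> exists2 z, rnorm z = 1 & dot z u = 0).
  exact: compact_sphere_dual.
(* If some unit [u] has no unit vector orthogonal to it, normalisation shows that its orthogonal
   complement is zero. *)
move=> /existsNP[u /not_implyP[u1 Hu]]; apply: (line_sphere_dual fiso u1) => // z zu.
apply/eqP; apply: contrapT => /negP z0; apply: Hu.
exists ((rnorm z)^-1%:C *: z); first exact: rnorm_normalize.
by rewrite dotZl zu mulr0.
Qed.

End complex_hilbert.

(* The inner product [dot] (linear in its first argument, conjugate-linear in
   the second) makes the complete normed space [H] a Hilbert space. *)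
Theorem corollary4p2 (R : realType) (H : completeNormedModType R[i])
    (dot : {dot H for conjC}) (dot_norm : forall x : H, dot x x = `|x| ^+ 2) :
  mazur_ulam_property (realification (compact_op H)).
Proof.
apply: mazur_ulam_property_dual => Y f fiso T T1.
exact: (compact_op_sphere_dual dot_norm fiso T1).
Qed.
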